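(* Let $I$ be a $d$-dimensional digital image. There are bijections between the barcodes of $I_T$ and of $(-I^\infty)_V$ (the latter reduced), and between the barcodes of $I_V$ and of $(-I^\infty)_T$ (the latter reduced), given for all $k$ by \begin{align*} [p,q) \in Dgm_k(I_V) &\longleftrightarrow [-q,-p) \in \widetilde{Dgm}_{d-k-1}\bigl((-I^\infty)_T\bigr),\\ [p,q) \in Dgm_k(I_T) &\longleftrightarrow [-q,-p) \in \widetilde{Dgm}_{d-k-1}\bigl((-I^\infty)_V\bigr). \end{align*} Here $q=\infty$ is allowed, in which case $[-q,-p)$ means $[-\infty,-p)$.
   Context: A \emph{$d$-dimensional digital image} ($d\ge 1$) is a $d$-dimensional rectangular array of real numbers, i.e. a function $I:\{1,\dots,n_1\}\times\cdots\times\{1,\dots,n_d\}\to\mathbb{R}$ with all $n_i\ge1$; elements of the index set are called pixels. The \emph{padded image} $I^\infty$ is the array indexed by $\{0,\dots,n_1+1\}\times\cdots\times\{0,\dots,n_d+1\}$ that agrees with $I$ on the pixels of $I$ and has value $\infty$ on the added single layer of boundary pixels. The image $-I^\infty$ is its pointwise negative, having value $-\infty$ on the added layer. Each image $J$ (with values in $\mathbb{R}\cup\{-\infty\}$) gives two filtered cubical complexes: (V-construction) $J_V$: the pixels are the vertices of the cubical complex. Its cells are the elementary cubes (products of $d$ factors, each a point $\{j\}$ or a unit interval $[j,j+1]$ with integer $j$) all of whose vertices are pixels; the function value of a cell is the maximum of the values of $J$ at its vertices. (T-construction) $J_T$: the pixels are the top-dimensional cells ($d$-dimensional unit cubes), arranged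 in the grid according to their array positions. The complex consists of these $d$-cubes and all their faces; the function value of a cell is the minimum of the values of $J$ on the $d$-cubes containing it. For a filtered complex $(X,f)$ (a complex with a cell-wise constant function whose sublevel sets $X_r=\{f\le r\}$ are subcomplexes), $Dgm_k$ denotes the degree-$k$ persistent homology barcode with coefficients in $\mathbb{Z}_2$ of the sublevel set filtration: the multiset of nonempty intervals $[b,e)$ recording the birth value $b$ and death value $e$ of the $k$-th homology classes in an interval decomposition of $r\mapsto H_k(X_r;\mathbb{Z}_2)$, with $e=\infty$ for classes that never die. When $f$ takes the value $-\infty$, the filtration is indexed by $r\in\mathbb{R}\cup\{-\infty\}$ and a bar has birth value $-\infty$ if it is already present in $X_{-\infty}=\{f=-\infty\}$. $\widetilde{Dgm}_k$ denotes the reduced barcode, in which the $0$-dimensional bar $[-\infty,\infty)_0$ is removed (from $Dgm_0$), and $\widetilde{Dgm}_k=Dgm_k$ for $k\neq0$. Barcodes in negative degrees are empty. *)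

(* Defs.v *)
From HB Require Import structures.
From mathcomp Require Import all_boot all_order all_algebra.
From mathcomp Require Import reals constructive_ereal.

Set Implicit Arguments.
Unset Strict Implicit.
Unset Printing Implicit Defensive.

Import Order.TTheory GRing.Theory Num.Theory.
Local Open Scope ring_scope.

(* MathComp has no quotients of vector spaces.  For W <= U, the quotient U / W *)
(* is carried by the complement U :\: W of W in U, the class map being the     *)
(* projection along W; qclass_eq0 and qclass_surj are its defining properties. *)
Section Quotient.
Variables (F : fieldType) (V : vectType F) (U W : {vspace V}).

Definition quotv : vectType F := subvs_of (U :\: W)%VS.

Definition qclass (v : V) : quotv := vsproj (U :\: W)%VS (addv_pi1 U W v).

Lemma qclass_is_linear : linear qclass.
Proof. by move=> a u v; rewrite /qclass !linearP. Qed.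

HB.instance Definition _ :=
  GRing.isLinear.Build F V quotv _ qclass qclass_is_linear.

Lemma qclass_eq0 v : v \in U -> (qclass v == 0) = (v \in W).
Proof.
move=> vU; have pi1UW : addv_pi1 U W v \in (U :\: W)%VS by apply: memv_pi.
have /addv_pi1_pi2 vE : v \in (U + W)%VS by apply: subvP vU; apply: addvSl.
apply/eqP/idP => [/(congr1 vsval) | vW].
  by rewrite vsprojK // linear0 => e; rewrite -vE e add0r memv_pi2.
rewrite /qclass; suff -> : addv_pi1 U W v = 0 by rewrite linear0.
by move: vE; rewrite addv_pi2_id // => /(canRL (addrK _)); rewrite subrr.
Qed.

Lemma qclass_surj (q : quotv) : exists2 v, v \in U & qclass v = q.
Proof.
have qUW : vsval q \in (U :\: W)%VS := subvsP q.
exists (vsval q); first by apply: subvP qUW; apply: diffvSl.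
by rewrite /qclass /addv_pi1 daddv_pi_id ?capv_diff // vsvalK.
Qed.

End Quotient.

(* A finite cell complex together with a value on each of its cells;           *)
(* cfacet c' c means that c' is a codimension-one face of c.                   *)
Record fcomplex (R : realType) := FComplex {
  cell : finType;
  cdim : cell -> nat;
  cfacet : rel cell;
  cval : cell -> \bar R }.

Section Homology.
Variables (R : realType) (X : fcomplex R).

Definition chain : vectType 'F_2 := {ffun cell X -> ('F_2)^o}.

Definition chain_of (c : cell X) : chain := [ffun c' => (c' == c)%:R].

Definition bdry_fun (x : chain) : chain :=
  [ffun c' => \sum_(c | cfacet c' c) x c].

Lemma bdry_is_linear : linear bdry_fun.
Proof.
move=> a x y; apply/ffunP => c; rewrite !ffunE scaler_sumr -big_split /=.
by apply: eq_bigr => c' _; rewrite !ffunE.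
Qed.

HB.instance Definition _ :=
  GRing.isLinear.Build 'F_2 chain chain _ bdry_fun bdry_is_linear.

Definition bdry : 'End(chain) := linfun bdry_fun.

(* Degrees are integers, so that the groups vanish in negative degrees. *)
Definition chains (k : int) (r : \bar R) : {vspace chain} :=
  <<[seq chain_of c | c <- enum [pred c | ((cdim c)%:Z == k)
                                          && (cval c <= r)%E]]>>%VS.

Definition cycles (k : int) (r : \bar R) : {vspace chain} :=
  (chains k r :&: lker bdry)%VS.

Definition boundaries (k : int) (r : \bar R) : {vspace chain} :=
  (bdry @: chains (k + 1) r)%VS.

Definition homology (k : int) (r : \bar R) : vectType 'F_2 :=
  quotv (cycles k r) (boundaries k r).

(* The map induced by X_r \subset X_s: the class in X_s of a representative. *)
Definition hmap (k : int) (r s : \bar R) (h : homology k r) : homology k s :=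
  qclass (cycles k s) (boundaries k s) (vsval h).

End Homology.

Section Barcode.
Variable R : realType.

(* (b, e) stands for the interval [b, e). *)
Definition bar := (\bar R * \bar R)%type.

Definition in_bar (r : \bar R) (b : bar) : bool := (b.1 <= r < b.2)%E.

(* The direct sum of the interval modules of the bars of B: at r, one copy of  *)
(* F_2 for each bar containing r.                                              *)
Definition active (B : seq bar) (r : \bar R) : finType :=
  {i : 'I_(size B) | in_bar r (tnth (in_tuple B) i)}.

Definition interval_sum (B : seq bar) (r : \bar R) : vectType 'F_2 :=
  {ffun active B r -> ('F_2)^o}.

Definition interval_map (B : seq bar) (r s : \bar R) (x : interval_sum B r) :
    interval_sum B s :=
  [ffun j => oapp (fun i : active B r => x i) 0 (insub (val j))].

(* B (a multiset, up to order) is the degree-k barcode of the sublevel set     *)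
(* filtration of X, indexed by r in R \cup {-oo}.                              *)
Definition is_barcode (X : fcomplex R) (k : int) (B : seq bar) : Prop :=
  all (fun b : bar => (b.1 < b.2)%E) B /\
  exists phi : forall r : \bar R, {linear interval_sum B r -> homology X k r},
    (forall r, (r < +oo)%E -> bijective (phi r)) /\
    (forall r s, (r <= s)%E -> (s < +oo)%E ->
       forall x, phi s (interval_map s x) = hmap s (phi r x)).

Definition reduced (k : int) (B : seq bar) : seq bar :=
  if k == 0 then rem (-oo%E, +oo%E) B else B.

Definition dual_bar (b : bar) : bar := (- b.2, - b.1)%E.

End Barcode.

Section Images.
Variable d : nat.

(* Positions are counted from 0 in each direction. *)
Definition pixel (m : 'I_d -> nat) : finType := {dffun forall i, 'I_(m i)}.

(* Elementary cubes with vertices in the box \prod_i {0, ..., m i - 1}: the    *)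
(* i-th factor is the point {j} when it is inl j, and the unit interval        *)
(* [j, j + 1] when it is inr j.                                                *)
Definition ecube (m : 'I_d -> nat) : finType :=
  {dffun forall i, ('I_(m i) + 'I_(m i).-1)%type}.

Section Cubes.
Variable m : 'I_d -> nat.
Implicit Type c : ecube m.

Definition is_edge c i : bool := if c i is inr _ then true else false.
Definition lo c i : nat := match c i with inl j => j | inr j => j end.
Definition hi c i : nat := match c i with inl j => j | inr j => j.+1 end.

Definition edim c : nat := #|[pred i | is_edge c i]|.

Definition face c' c : bool :=
  [forall i, (lo c i <= lo c' i)%N && (hi c' i <= hi c i)%N].

Definition facet c' c : bool := face c' c && (edim c == (edim c').+1).

End Cubes.

Variable R : realType.

Section Constructions.
Variables (m : 'I_d -> nat) (J : pixel m -> \bar R).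

Definition vertex_of (p : pixel m) : ecube m := [ffun i => inl (p i)].

Definition Vcomplex : fcomplex R :=
  @FComplex R (ecube m) (@edim m) (@facet m)
    (fun c => \big[Order.max/-oo%E]_(p | face (vertex_of p) c) J p).

(* When all m i > 0, every elementary cube of the box with m i + 1 vertices in *)
(* direction i is a face of the d-cube of some pixel.                          *)
Definition cube_of (p : pixel m) : ecube (fun i => (m i).+1) :=
  [ffun i => inr (p i)].

Definition Tcomplex : fcomplex R :=
  @FComplex R (ecube (fun i => (m i).+1)) (@edim _) (@facet _)
    (fun c => \big[Order.min/+oo%E]_(p | face c (cube_of p)) J p).

End Constructions.

Variables (n : 'I_d -> nat) (I : pixel n -> R).

Definition ext_image : pixel n -> \bar R := fun p => (I p)%:E.

Definition padded (p : pixel (fun i => (n i).+2)) : \bar R :=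
  if [pick q : pixel n | [forall i, p i == (q i).+1 :> nat]] is Some q
  then (I q)%:E else +oo%E.

Definition neg_padded (p : pixel (fun i => (n i).+2)) : \bar R :=
  (- padded p)%E.

End Images.

(* Main.v *)
Require Import Defs.
From HB Require Import structures.
From mathcomp Require Import all_boot all_order all_algebra.
From mathcomp Require Import reals constructive_ereal.
From mathcomp Require Import zify.

(* A barcode is determined by the ranks of the maps H_k(X_r) -> H_k(X_s), and    *)
(* each of them is an alternating sum of ranks of submatrices of the boundary   *)
(* matrix of X.  The V-complex of I is dual to the complement, in the T-complex *)
(* of -I^oo, of the subcomplex of value -oo (and likewise with V and T          *)
(* exchanged): dualizing cells transposes the boundary matrix, negates values,  *)
(* and turns X_r into the complement of K_{-r}.  Since K, a box, is acyclic,    *)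
(* complementary submatrices of its boundary matrix have related ranks, and     *)
(* the rank for X at (r, s) in degree k equals the rank for K at (-s, -r) in    *)
(* degree d-k-1, up to the class of a point in degree 0.                        *)

Set Implicit Arguments.
Unset Strict Implicit.
Unset Printing Implicit Defensive.

Import Order.TTheory GRing.Theory Num.Theory.
Local Open Scope ring_scope.

(** Dualizing cells embeds the complex [X] of the image into the complex [K] of the negated padded
    image, reversing faces and negating values. Every cell of [K] missed by the embedding has value
    -oo, so for a real [r] that is not a cell value [X_r] is carried exactly onto the complement of
    [K_{-r}]. Its boundary matrix is the transpose of that of the pair [(K, K_{-r})], so degree [k]
    homology of [X_r] matches degree [d - k] cohomology of the pair. Since [K] is a box, its reduced
    homology vanishes, and the exact sequence of the pair shifts this to reduced degree [d - k - 1]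
    of [K_{-r}].

    No isomorphism is built: only ranks are compared. [rank_hmap] expresses the rank of
    [H_k(X_r) -> H_k(X_s)] through numbers of cells and ranks of blocks of the boundary matrix.
    [exactness_rank] is the acyclicity of [K] in the same language, obtained from [box_acyclic],
    where the box is contracted one coordinate at a time. [duality_rank] combines the two; the class
    of a point accounts for the extra 1 in degree 0. Finally [barcode_count] reads each rank as the
    number of bars born by [r] and alive at [s], and [count_bars_perm] recovers the multiset of bars
    from these numbers. The embeddings are [dual_VT] and [dual_TV]. *)

Local Notation F2 := (('F_2)^o).
Local Notation interval k := ('I_k + 'I_k.-1)%type.

(** * Ranks of 0-1 matrices over F_2 *)

Section Support.
Variable S : finType.
Implicit Types (P : pred S) (x : {ffun S -> F2}).

Definition delta_ffun (c : S) : {ffun S -> F2} := [ffun c' => (c' == c)%:R].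

(** Spelled so that [chains] is convertible to it; [mem_supp_space] then trades spans for vanishing
    conditions. *)
Definition supp_space P : {vspace {ffun S -> F2}} :=
  <<[seq delta_ffun c | c <- enum P]>>%VS.

Lemma mem_supp_space P x :
  reflect (forall c, c \notin P -> x c = 0) (x \in supp_space P).
Proof.
apply: (iffP idP) => [xP c cP | xP].
  have /coord_span -> := xP.
  rewrite sum_ffunE big1 // => i _; rewrite !ffunE.
  have si : (i < size (enum P))%N by rewrite -cardE ltn_ord.
  have i_P : nth c (enum P) i \in enum P by rewrite mem_nth.
  rewrite (nth_map c) // ffunE; case: eqP => [cE|_]; last by rewrite scaler0.
  by rewrite cE -(mem_enum P) i_P in cP.
have -> : x = \sum_(c in P) x c *: delta_ffun c.
  apply/ffunP => c; rewrite sum_ffunE.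
  have [cP | cP] := boolP (c \in P).
    rewrite (bigD1 c) //= big1 => [|c' /andP[_ cc']]; rewrite !ffunE.
      by rewrite eqxx addr0 /GRing.scale /= mulr1.
    by rewrite eq_sym (negbTE cc') scaler0.
  rewrite xP // big1 // => c' c'P; rewrite !ffunE.
  by case: eqP cP c'P => [-> /negbTE -> | _ _ _] //; rewrite scaler0.
apply: memv_suml => c cP; apply/memvZ/memv_span/mapP.
by exists c => //; rewrite mem_enum.
Qed.

Lemma dim_supp_space P : \dim (supp_space P) = #|P|.
Proof.
have -> : #|P| = size [seq delta_ffun c | c <- enum P].
  by rewrite size_map cardE.
apply/eqP; rewrite -[_ == _]/(free _); apply/freeP => k kE i.
have si : (i < size (enum P))%N by rewrite -cardE ltn_ord.
pose c0 := enum_val i; have /ffunP/(_ (nth c0 (enum P) i)) := kE.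
rewrite sum_ffunE (bigD1 i) //= big1 => [|j ji].
  by rewrite !ffunE (nth_map c0) // ffunE eqxx addr0 /GRing.scale /= mulr1.
have sj : (j < size (enum P))%N by rewrite -cardE ltn_ord.
rewrite !ffunE (nth_map c0) // ffunE nth_uniq ?enum_uniq // eq_sym.
by rewrite (inj_eq val_inj) (negbTE ji) scaler0.
Qed.

End Support.

Section RelRank.
Variables (S T : finType).
Implicit Type e : S -> T -> bool.

Definition rel_mx e : 'M['F_2]_(#|S|, #|T|) :=
  \matrix_(i, j) (e (enum_val i) (enum_val j))%:R.

Definition rel_rank e : nat := \rank (rel_mx e).

Lemma eq_rel_rank e e' : (forall s t, e s t = e' s t) -> rel_rank e = rel_rank e'.
Proof. by move=> ee'; congr (\rank _); apply/matrixP => i j; rewrite !mxE ee'. Qed.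

Lemma rel_rank0 e : (forall s t, e s t = false) -> rel_rank e = 0%N.
Proof.
move=> e0; rewrite /rel_rank; have -> : rel_mx e = 0; last by rewrite mxrank0.
by apply/matrixP => i j; rewrite !mxE e0.
Qed.

End RelRank.

Lemma rel_rank_tr (S T : finType) (e : S -> T -> bool) :
  rel_rank (fun t s => e s t) = rel_rank e.
Proof.
by rewrite /rel_rank -mxrank_tr; congr (\rank _); apply/matrixP => i j; rewrite !mxE.
Qed.

Lemma rel_rank_sub (S T S' T' : finType) (e : S -> T -> bool) (e' : S' -> T' -> bool)
    (f : S -> S') (g : T -> T') :
  (forall s t, e s t = e' (f s) (g t)) -> (rel_rank e <= rel_rank e')%N.
Proof.
move=> ee'; rewrite /rel_rank.
pose f' (i : 'I_#|S|) := enum_rank (f (enum_val i)).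
pose g' (j : 'I_#|T|) := enum_rank (g (enum_val j)).
have -> : rel_mx e = rowsub f' (colsub g' (rel_mx e')).
  by apply/matrixP => i j; rewrite !mxE /f' /g' !enum_rankK ee'.
apply: leq_trans (mxrankS (rowsub_sub _ _)) _.
by rewrite -mxrank_tr trmx_mxsub -[leqRHS]mxrank_tr (mxrankS (rowsub_sub _ _)).
Qed.

(** All nonzero entries of [e'] lie in the block indexed by the images of [f] and [g]. The selection
    matrices [L] and [M] pad that block with zeros, which cannot raise the rank. *)
Lemma rel_rank_inj (S T S' T' : finType) (e : S -> T -> bool) (e' : S' -> T' -> bool)
    (f : S -> S') (g : T -> T') : injective f -> injective g ->
  (forall s t, e s t = e' (f s) (g t)) ->
  (forall s' t', e' s' t' -> s' \in codom f /\ t' \in codom g) ->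
  rel_rank e = rel_rank e'.
Proof.
move=> f_inj g_inj ee' e'fg; apply/eqP; rewrite eqn_leq (rel_rank_sub ee') /=.
pose L : 'M['F_2]_(#|S'|, #|S|) := \matrix_(i, j) (enum_val i == f (enum_val j))%:R.
pose M : 'M['F_2]_(#|T|, #|T'|) := \matrix_(i, j) (g (enum_val i) == enum_val j)%:R.
rewrite /rel_rank; suff -> : rel_mx e' = L *m rel_mx e *m M.
  exact: leq_trans (mxrankM_maxl _ _) (mxrankM_maxr _ _).
apply/matrixP => i j; rewrite !mxE.
case e'ij: (e' _ _); last first.
  rewrite big1 // => l _; rewrite !mxE; case: eqP => [gl|_]; last by rewrite mulr0.
  rewrite big1 ?mul0r // => h _; rewrite !mxE; case: eqP => [fh|_];
    last by rewrite mul0r.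
  by rewrite ee' gl -fh e'ij mulr0.
have [/codomP[s sE] /codomP[t tE]] := e'fg _ _ e'ij.
rewrite (bigD1 (enum_rank t)) //= [X in _ + X]big1 => [|l lt]; rewrite !mxE.
  rewrite (bigD1 (enum_rank s)) //= [X in (_ + X) * _]big1 => [|h hs]; rewrite !mxE.
    by rewrite !enum_rankK sE tE !eqxx ee' -sE -tE e'ij !addr0 !mulr1.
  case: eqP => [|_]; last by rewrite mul0r.
  by rewrite sE => /f_inj sh; rewrite sh enum_valK eqxx in hs.
case: eqP => [|_]; last by rewrite mulr0.
by rewrite tE => /g_inj sh; rewrite -sh enum_valK eqxx in lt.
Qed.

Section RowFfun.
Variables (S : finType) (r : nat) (A : 'M['F_2]_(#|S|, r)) (B : 'M['F_2]_(r, #|S|)).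

Definition row_of_ffun (x : {ffun S -> F2}) : 'rV['F_2]_r :=
  (\row_j (x (enum_val j) : 'F_2)) *m A.

Definition ffun_of_row (v : 'rV['F_2]_r) : {ffun S -> F2} :=
  [ffun s => (v *m B) 0 (enum_rank s)].

Lemma row_of_ffun_is_linear : linear row_of_ffun.
Proof.
move=> a x y; rewrite /row_of_ffun scalemxAl -mulmxDl; congr (_ *m _).
by apply/rowP => i; rewrite !mxE !ffunE.
Qed.

HB.instance Definition _ :=
  GRing.isLinear.Build 'F_2 _ _ _ row_of_ffun row_of_ffun_is_linear.

Lemma ffun_of_row_is_linear : linear ffun_of_row.
Proof.
by move=> a x y; apply/ffunP => s; rewrite !ffunE mulmxDl -scalemxAl !mxE.
Qed.

HB.instance Definition _ :=
  GRing.isLinear.Build 'F_2 _ _ _ ffun_of_row ffun_of_row_is_linear.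

Lemma row_of_ffun_surj : row_full A -> forall v, exists x, row_of_ffun x = v.
Proof.
move=> fullA v; have /submxP[u ->] : (v <= A)%MS by apply: submx_full.
exists [ffun s => u 0 (enum_rank s)]; congr (_ *m _).
by apply/rowP => j; rewrite !mxE ffunE enum_valK.
Qed.

Lemma ffun_of_row_inj : row_free B -> injective ffun_of_row.
Proof.
move=> freeB u v /ffunP uv; apply: (row_free_inj freeB); apply/rowP => j.
by have := uv (enum_val j); rewrite !ffunE enum_valK.
Qed.

End RowFfun.

Section Nullity.
Variables (S T : finType) (e : S -> T -> bool).

Definition rel_fun (x : {ffun T -> F2}) : {ffun S -> F2} :=
  [ffun s => \sum_(t | e s t) x t].

Lemma rel_fun_is_linear : linear rel_fun.
Proof.
move=> a x y; apply/ffunP => c; rewrite !ffunE scaler_sumr -big_split /=.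
by apply: eq_bigr => c' _; rewrite !ffunE.
Qed.

HB.instance Definition _ :=
  GRing.isLinear.Build 'F_2 _ _ _ rel_fun rel_fun_is_linear.

(** The full-rank factorization [col_base *m row_base] splits the map into a surjection onto a space
    of dimension the rank, followed by an injection. *)
Lemma dim_limg_rel_fun : \dim (limg (linfun rel_fun)) = rel_rank e.
Proof.
pose A := (rel_mx e)^T.
pose p := row_of_ffun (col_base A); pose q := ffun_of_row (row_base A).
have qpE x : rel_fun x = q (p x).
  apply/ffunP => s; rewrite !ffunE -mulmxA mulmx_base !mxE.
  rewrite (reindex_onto enum_val enum_rank) /=.
    rewrite big_mkcond /=; under [RHS]eq_bigr do rewrite !mxE enum_rankK.
    apply: eq_bigr => i _; rewrite enum_valK eqxx andbT.
    by case: (e _ _); rewrite ?mulr1 ?mulr0.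
  by move=> t _; rewrite enum_rankK.
have -> : linfun rel_fun = (linfun q \o linfun p)%VF.
  by apply/lfunP => x; rewrite comp_lfunE !lfunE /= qpE.
rewrite limg_comp limg_dim_eq.
  have -> : limg (linfun p) = fullv.
    apply/vspaceP => v; rewrite memvf.
    have [|x <-] := @row_of_ffun_surj _ _ (col_base A) _ v.
      exact: col_base_full.
    by rewrite -[row_of_ffun _ _](lfunE p) memv_img ?memvf.
  by rewrite dimvf dim_matrix; transitivity (\rank A);
    [exact: mul1n | exact: mxrank_tr].
have -> : lker (linfun q) = 0%VS.
  apply/eqP/lker0P => u v; rewrite !lfunE; apply: ffun_of_row_inj.
  exact: row_base_free.
by rewrite capv0.
Qed.

End Nullity.


(** * Rank-nullity for blocks of the boundary matrix *)

Section Complexes.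
Variables (R : realType) (X : fcomplex R).
Implicit Types (P Q : pred (cell X)) (x y : chain X).

(** Rows outside [P] and columns outside [Q] are zeroed rather than deleted, so blocks share their
    index types and are compared by comparing relations. *)
Definition bdry_rank P Q : nat :=
  rel_rank (fun c' c : cell X => [&& P c', Q c & cfacet c' c]).

Lemma bdryE x : bdry X x = bdry_fun x.
Proof. by rewrite lfunE. Qed.

(** The kernel of the block consists of the chains on [Q] whose boundary vanishes on [P], that is,
    is supported off [P]. *)
Lemma nullity P Q :
  (\dim (supp_space Q :&: bdry X @^-1: supp_space (predC P))
   + bdry_rank P Q)%N = #|Q|.
Proof.
rewrite /bdry_rank -dim_limg_rel_fun -dim_supp_space.
set g := linfun _.
have gE x : g x = [ffun c' => \sum_(c | [&& P c', Q c & cfacet c' c]) x c].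
  by rewrite lfunE.
have -> : limg g = (g @: supp_space Q)%VS.
  apply/vspaceP => v; apply/memv_imgP/memv_imgP => [[x _ ->]|[x xQ ->]]; last first.
    by exists x; rewrite ?memvf.
  exists [ffun c => if c \in Q then x c else 0].
    by apply/mem_supp_space => c cQ; rewrite ffunE (negbTE cQ).
  rewrite !gE; apply/ffunP => c'; rewrite !ffunE; apply: eq_bigr => c /and3P[_ cQ _].
  by rewrite ffunE [c \in Q]cQ.
rewrite -[RHS](limg_ker_dim g); congr (\dim _ + _)%N; apply/vspaceP => x.
rewrite !memv_cap; case xQ: (x \in _) => //=; move/mem_supp_space in xQ.
have sumE c' : P c' -> \sum_(c | [&& P c', Q c & cfacet c' c]) x c = bdry_fun x c'.
  move=> c'P; rewrite ffunE big_mkcond [RHS]big_mkcond /=; apply: eq_bigr => c _.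
  rewrite c'P /=; case: (cfacet _ _); rewrite ?andbF // andbT.
  by case: ifP => // /negbT /xQ.
rewrite memv_ker -memv_preim bdryE gE.
apply/mem_supp_space/eqP => [xP|/ffunP xP c' c'P].
  apply/ffunP => c'; rewrite !ffunE.
  have [c'P | /negbTE c'P] := boolP (P c');
    last by rewrite big1 // => c; rewrite c'P.
  by rewrite -c'P sumE // xP // !inE c'P.
rewrite !inE negbK in c'P.
by have := xP c'; rewrite ffunE sumE // => ->; rewrite ffunE.
Qed.

End Complexes.

(** * Ranks of the maps in homology *)

Lemma qclass0P (F : fieldType) (V : vectType F) (U W : {vspace V}) (v : V) :
  v \in U -> reflect (qclass U W v = 0) (v \in W).
Proof. by move=> vU; rewrite -(qclass_eq0 W vU); apply: eqP. Qed.

(** [hmap] acts on the chosen representative of a class; this bounds the error made by replacing a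
    cycle by that representative. *)
Lemma vsval_qclass (F : fieldType) (V : vectType F) (U W : {vspace V}) (v : V) :
  v \in U -> v - vsval (qclass U W v) \in W.
Proof.
move=> vU; rewrite /qclass vsprojK ?memv_pi //.
have /addv_pi1_pi2 vE : v \in (U + W)%VS by apply: subvP vU; apply: addvSl.
suff -> : v - addv_pi1 U W v = addv_pi2 U W v by rewrite memv_pi2.
by apply/eqP; rewrite subr_eq addrC vE.
Qed.

Record cell_complex (R : realType) (X : fcomplex R) : Prop := CellComplex {
  cfacet_dim : forall c' c : cell X, cfacet c' c -> cdim c = (cdim c').+1;
  cfacet_val : forall c' c : cell X, cfacet c' c -> (cval c' <= cval c)%E;
  bdry_funK : forall x : chain X, bdry_fun (bdry_fun x) = 0 }.

Section RankFormula.
Variables (R : realType) (X : fcomplex R).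
Implicit Types (k : int) (r s : \bar R).

Definition level k r : pred (cell X) :=
  [pred c | ((cdim c)%:Z == k) && (cval c <= r)%E].

Lemma chainsE k r : chains X k r = supp_space (level k r).
Proof. by []. Qed.

Lemma hmap_is_linear k r s : linear (@hmap R X k r s).
Proof.
move=> a u v; rewrite /hmap.
have -> : vsval (a *: u + v) = a *: vsval u + vsval v by [].
exact: linearP.
Qed.

HB.instance Definition _ k r s :=
  GRing.isLinear.Build 'F_2 _ _ _ (@hmap R X k r s) (@hmap_is_linear k r s).

Lemma chainsS k r s : (r <= s)%E -> (chains X k r <= chains X k s)%VS.
Proof.
move=> rs; apply/subvP => x /mem_supp_space xr; apply/mem_supp_space => c.
rewrite !inE => /negP cs; apply: xr; rewrite !inE; apply/negP => /andP[ck cr].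
by apply: cs; rewrite ck (le_trans cr).
Qed.

(** The image consists of the classes in [X_s] of cycles of [X_r]; a cycle of [X_r] dies there
    exactly when it bounds in [X_s]. *)
Lemma dim_limg_hmap k r s : (r <= s)%E ->
  (\dim (limg (linfun (@hmap R X k r s))) +
   \dim (cycles X k r :&: boundaries X k s))%N = \dim (cycles X k r).
Proof.
move=> rs; have Zrs : (cycles X k r <= cycles X k s)%VS.
  by apply: capvS => //; apply: chainsS.
have Brs : (boundaries X k r <= boundaries X k s)%VS by apply/limgS/chainsS.
pose q := linfun (qclass (cycles X k s) (boundaries X k s)).
have -> : limg (linfun (@hmap R X k r s)) = (q @: cycles X k r)%VS.
  apply/vspaceP => v; apply/memv_imgP/memv_imgP => [[h _ ->]|[z zr ->]].
    exists (vsval h); first exact: subvP (diffvSl _ _) _ (subvsP h).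
    by rewrite !lfunE.
  exists (qclass (cycles X k r) (boundaries X k r) z); first exact: memvf.
  rewrite !lfunE /= /hmap; set z1 := vsval _.
  have z1r : z1 \in cycles X k r.
    exact: (subvP (diffvSl _ (boundaries X k r))) _ (subvsP _).
  apply: subr0_eq; rewrite -linearB; apply/qclass0P.
    by rewrite (subvP Zrs) // memvB.
  exact/(subvP Brs)/vsval_qclass.
rewrite -[RHS](limg_ker_dim q) addnC; congr (\dim _ + _)%N.
apply/vspaceP => z; rewrite memv_cap [RHS]memv_cap.
case zr: (z \in cycles X k r) => //=.
rewrite memv_ker lfunE /=; have zs := subvP Zrs _ zr.
by apply/idP/eqP => /(qclass0P (boundaries X k s) zs).
Qed.

Hypothesis Xc : cell_complex X.

Lemma cyclesE k r : cycles X k r =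
  (supp_space (level k r) :&: bdry X @^-1: supp_space (predC predT))%VS.
Proof.
rewrite /cycles chainsE; congr (_ :&: _)%VS; apply/vspaceP => x.
rewrite memv_ker -memv_preim; apply/eqP/mem_supp_space => [-> c|x0].
  by rewrite ffunE.
by apply/ffunP => c; rewrite x0 // ffunE.
Qed.

(** The intersection is the image under the boundary of [W], the chains of [X_s] whose boundary lies
    in [X_r]. Its dimension is that of [W] minus that of the cycles of [X_s], and [nullity] computes
    both from the same set of columns. *)
Lemma dim_cycles_boundaries k r s : (r <= s)%E ->
  (\dim (cycles X k r :&: boundaries X k s) +
   bdry_rank (predC (level k r)) (level (k + 1) s))%N =
  bdry_rank predT (level (k + 1) s).
Proof.
move=> rs.
pose W := (supp_space (level (k + 1) s) :&:
           bdry X @^-1: supp_space (predC (predC (level k r))))%VS.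
have -> : (cycles X k r :&: boundaries X k s)%VS = (bdry X @: W)%VS.
  apply/vspaceP => z; rewrite memv_cap; apply/andP/memv_imgP => [[]|].
    rewrite memv_cap => /andP[zr _] /memv_imgP[x xs zE]; exists x => //.
    rewrite memv_cap xs -memv_preim -zE /=; apply/mem_supp_space => c.
    by rewrite !inE negbK => crk; move/mem_supp_space: zr; apply; rewrite !inE.
  case=> x; rewrite memv_cap -memv_preim => /andP[xs bx] ->; split; last first.
    exact: memv_img.
  rewrite memv_cap memv_ker !bdryE bdry_funK // eqxx andbT.
  apply/mem_supp_space => c crk; rewrite -bdryE.
  by move/mem_supp_space: bx; apply; rewrite !inE negbK.
have := nullity predT (level (k + 1) s).
rewrite -(nullity (predC (level k r)) (level (k + 1) s)) -/W -cyclesE.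
rewrite -(limg_ker_dim (bdry X) W) -addnA.
have -> : (W :&: lker (bdry X) = cycles X (k + 1) s)%VS.
  apply/vspaceP => z; rewrite !memv_cap -chainsE; case: (z \in chains _ _ _) => //=.
  rewrite memv_ker; case: eqP => [bz|]; rewrite ?andbF // andbT.
  by rewrite -memv_preim bz mem0v.
by move/addnI => ->.
Qed.

Lemma dim_cycles k r :
  (\dim (cycles X k r) + bdry_rank predT (level k r))%N = #|level k r|.
Proof. by rewrite cyclesE nullity. Qed.

(** Stated additively, to avoid truncated subtraction: the rank is the dimension of the cycles of
    [X_r] minus that of those bounding in [X_s]. *)
Lemma rank_hmap k r s : (r <= s)%E ->
  (\dim (limg (linfun (@hmap R X k r s))) + bdry_rank predT (level k r)
    + bdry_rank predT (level (k + 1) s))%N =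
  (#|level k r| + bdry_rank (predC (level k r)) (level (k + 1) s))%N.
Proof.
move=> rs; have := dim_limg_hmap k rs; have := dim_cycles k r.
have := dim_cycles_boundaries k rs; lia.
Qed.

End RankFormula.

(** * Bars counted by ranks *)

Section BarcodeCount.
Variables (R : realType).

Lemma interval_map_is_linear (B : seq (bar R)) r s : linear (@interval_map R B r s).
Proof.
move=> a x y; apply/ffunP => j; rewrite !ffunE.
by case: insub => [i|] /=; rewrite ?ffunE ?scaler0 ?addr0.
Qed.

HB.instance Definition _ (B : seq (bar R)) r s :=
  GRing.isLinear.Build 'F_2 _ _ _ (@interval_map R B r s)
    (@interval_map_is_linear B r s).

Lemma dim_limg_interval_map (B : seq (bar R)) r s : (r <= s)%E ->
  \dim (limg (linfun (@interval_map R B r s))) =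
  count (fun b : bar R => (b.1 <= r)%E && (s < b.2)%E) B.
Proof.
move=> rs.
pose P := [pred j : active B s | in_bar r (tnth (in_tuple B) (val j))].
have -> : limg (linfun (@interval_map R B r s)) = supp_space P.
  apply/vspaceP => v; apply/memv_imgP/mem_supp_space => [[x _ ->] j jP|vP].
    by rewrite lfunE /= ffunE insubF //; apply: negbTE.
  (* The preimage is [v] transported backwards from [s] to [r]: it keeps the coordinates of the bars
     active at both. *)
  exists (interval_map r v); first exact: memvf.
  rewrite lfunE /=; apply/ffunP => j; rewrite ffunE.
  case: insubP => [i _ ij|jr] /=; last by rewrite vP.
  by rewrite ffunE ij valK.
rewrite dim_supp_space -(card_image val_inj) -sum1_count -sum1_card [RHS]big_tnth.
apply: eq_bigl => i.
apply/imageP/andP => [[j jP ->]|[ir si]].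
  have := valP j; move: jP; rewrite !inE /in_bar /= => /andP[-> _] /andP[_ ->].
  by [].
have is_ : in_bar s (tnth (in_tuple B) i).
  by rewrite /in_bar /= (le_trans ir rs).
exists (Sub i is_) => //; rewrite !inE /= /in_bar ir /=.
exact: le_lt_trans si.
Qed.

(** The isomorphisms [phi] intertwine the maps of the interval sum with those in homology, so both
    have the same rank. *)
Lemma barcode_count (X : fcomplex R) k (B : seq (bar R)) r s :
  is_barcode X k B -> (r <= s)%E -> (s < +oo)%E ->
  count (fun b : bar R => (b.1 <= r)%E && (s < b.2)%E) B =
  \dim (limg (linfun (@hmap R X k r s))).
Proof.
move=> [_ [phi [phi_bij phiE]]] rs sy; rewrite -dim_limg_interval_map //.
set im := linfun _; set hm := linfun _.
pose ps := linfun (phi s).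
have comm : (ps \o im = hm \o linfun (phi r))%VF.
  by apply/lfunP => x; rewrite !comp_lfunE !lfunE /= phiE.
have -> : \dim (limg im) = \dim (limg (ps \o im)%VF).
  rewrite limg_comp [RHS]limg_dim_eq //.
  have -> : lker ps = 0%VS; last by rewrite capv0.
  apply/eqP/lker0P => u v; by rewrite !lfunE => /(bij_inj (phi_bij s sy)).
rewrite comm limg_comp; congr (\dim (_ @: _)%VS); apply/vspaceP => v.
rewrite memvf; apply/memv_imgP.
have [g _ gK] := phi_bij r (le_lt_trans rs sy).
by exists (g v); rewrite ?memvf // lfunE /= gK.
Qed.

End BarcodeCount.

(** * The interval *)

Lemma addF2_self (x : F2) : x + x = 0.
Proof. exact: (@addrr_pchar2 'F_2). Qed.

Lemma addff_self (S : finType) (x : {ffun S -> F2}) : x + x = 0.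
Proof. by apply/ffunP => s; rewrite !ffunE addF2_self. Qed.

(** Off-diagonal terms cancel in pairs in characteristic 2; this is what gives that the boundary of
    a boundary is zero. *)
Lemma sum_sym_F2 (S : finType) (d : nat) (F : 'I_d -> 'I_d -> {ffun S -> F2}) :
  (forall i, F i i = 0) -> (forall i j, i != j -> F i j = F j i) ->
  \sum_(i < d) \sum_(j < d) F i j = 0.
Proof.
move=> F0 FC.
have -> : \sum_(i < d) \sum_(j < d) F i j =
    \sum_(i < d) \sum_(j < d) (if (i < j)%N then F i j else 0)
    + \sum_(i < d) \sum_(j < d) (if (j < i)%N then F i j else 0).
  rewrite -big_split; apply: eq_bigr => i _; rewrite -big_split.
  apply: eq_bigr => j _ /=.
  by case: ltngtP => [||/val_inj ->]; rewrite ?addr0 ?add0r ?F0.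
rewrite [X in _ + X]exchange_big /=.
rewrite [X in _ + X](_ : _ =
    \sum_(i < d) \sum_(j < d) (if (i < j)%N then F i j else 0)).
  exact: addff_self.
apply: eq_bigr => i _; apply: eq_bigr => j _; case: ifP => // ij.
by rewrite FC // neq_ltn ij orbT.
Qed.

Lemma sum_ord_pick (N a : nat) (f : nat -> F2) :
  \sum_(l < N) ((l == a :> nat)%:R : F2) * f l = if (a < N)%N then f a else 0.
Proof.
case: ifP => aN.
  rewrite (bigD1 (Ordinal aN)) //= eqxx mul1r big1 ?addr0 // => l la.
  by rewrite -[l == a :> nat]/(l == Ordinal aN) (negbTE la) mul0r.
rewrite big1 // => l _; case: eqP => [la|_]; last by rewrite mul0r.
by rewrite -la ltn_ord in aN.
Qed.

Section Interval.
Variable n : nat.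
Implicit Types a b : interval n.

Definition lo1 a : nat := match a with inl j => j | inr j => j end.
Definition hi1 a : nat := match a with inl j => j | inr j => j.+1 end.
Definition edge1 a : bool := if a is inr _ then true else false.
Definition face1 a' a : bool := (lo1 a <= lo1 a')%N && (hi1 a' <= hi1 a)%N.

Definition end1 a' a : bool := [&& face1 a' a, ~~ edge1 a' & edge1 a].

Lemma face1E a' a : face1 a' a = (a' == a) || end1 a' a.
Proof.
have eqP1 : forall (x y : interval n), (x == y) = (edge1 x == edge1 y) && (lo1 x == lo1 y).
  by case=> i [] j.
rewrite eqP1 /end1 /face1; case: a' a => i [] j /=; lia.
Qed.

Definition bd1 a' a : F2 := (end1 a' a)%:R.
(* Matrices of the cone operator v_j |-> [0, j] and of the retraction v_j |-> v_0. *)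
Definition cone1 a' a : F2 := [&& edge1 a', ~~ edge1 a & lo1 a' < lo1 a]%N%:R.
Definition base1 a' a : F2 := [&& ~~ edge1 a', ~~ edge1 a & lo1 a' == 0]%N%:R.

Lemma bd1_inr a' (l : 'I_n.-1) : bd1 a' (inr l) =
  if a' is inl j then (j == l :> nat)%:R + (j == l.+1 :> nat)%:R else 0.
Proof.
rewrite /bd1 /end1 /face1; case: a' => j /=; last by rewrite andbF.
rewrite andbT; case: (ltngtP j l) => [jl|jl|->].
- by rewrite ltn_eqF ?addr0 // (leq_trans jl).
- by rewrite add0r; congr (_%:R); lia.
- by rewrite leqnSn ltn_eqF ?addr0.
Qed.

Lemma bd1_inl a' (j : 'I_n) : bd1 a' (inl j) = 0.
Proof. by rewrite /bd1 /end1 !andbF. Qed.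

Lemma bd1K a' a : \sum_b bd1 a' b * bd1 b a = 0.
Proof.
apply: big1 => -[j|l] _; first by rewrite bd1_inl mul0r.
by case: a => k; rewrite ?bd1_inl ?bd1_inr mulr0.
Qed.

Lemma bd1_sum a : \sum_b bd1 b a = 0.
Proof.
case: a => [j|l]; first by rewrite big1 // => b _; rewrite bd1_inl.
rewrite big_sumType /= [X in _ + X]big1 ?addr0 => [|k _]; last by rewrite bd1_inr.
under eq_bigr do rewrite bd1_inr -[X in X + _]mulr1 -[X in _ + X]mulr1.
rewrite big_split /= (sum_ord_pick n l (fun=> 1)) (sum_ord_pick n l.+1 (fun=> 1)).
have := ltn_ord l => ln; have -> : (l < n)%N by lia.
have -> : (l.+1 < n)%N by lia.
exact: addF2_self.
Qed.

(** On a vertex, the boundary of [[0, j]] telescopes to [v_j + v_0]. On an edge, the cones [[0, l]]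
    and [[0, l + 1]] of its two ends differ by the edge itself. *)
Lemma cone1_homotopy a' a :
  \sum_b bd1 a' b * cone1 b a + \sum_b cone1 a' b * bd1 b a =
  (a' == a)%:R + base1 a' a.
Proof.
case: a' a => [j'|l'] [j|l].
- rewrite [X in _ + X]big1 ?addr0 => [|b _]; last by rewrite bd1_inl mulr0.
  rewrite big_sumType /= big1 ?add0r => [|b _]; last by rewrite bd1_inl mul0r.
  rewrite /base1 /cone1 /=.
  (* Vertex 0 is an end of at most one edge, whereas vertex [k + 1] ends edge [k] and, unless it is
     last, edge [k + 1]. *)
  case j'0 : (nat_of_ord j') => [|k].
    under eq_bigr => l _.
      rewrite bd1_inr j'0 addr0 eq_sym. over.
    rewrite (sum_ord_pick _ _ (fun l => (l < j)%N%:R)) /=.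
    rewrite -[inl j' == inl j]/(j' == j :> nat) j'0.
    case: (nat_of_ord j) (ltn_ord j) => [|h] /= hn.
      by rewrite addF2_self if_same.
    have -> : (0 < n.-1)%N by lia.
    by rewrite add0r.
  under eq_bigr => l _.
    rewrite bd1_inr j'0 eqSS mulrDl ![_ == nat_of_ord l]eq_sym. over.
  rewrite big_split /= (sum_ord_pick _ _ (fun l => (l < j)%N%:R)).
  rewrite (sum_ord_pick _ _ (fun l => (l < j)%N%:R)) /=.
  rewrite -[inl j' == inl j]/(j' == j :> nat) j'0 addr0.
  have := ltn_ord j; have := ltn_ord j'; rewrite j'0 => kn jn.
  have -> : (k < n.-1)%N by lia.
  case: (ltngtP k.+1 j) => kj.
  + have -> : (k.+1 < n.-1)%N by lia.
    exact: addF2_self.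
  + by rewrite if_same addr0.
  + by rewrite if_same add0r.
- rewrite !big1 => [|b _|b _]; first by rewrite /base1 /= !addr0.
  + by rewrite /cone1 /= mul0r.
  + by rewrite /cone1 /= !andbF mulr0.
- rewrite !big1 => [|b _|b _]; first by rewrite /base1 /= !addr0.
  + by rewrite bd1_inl mulr0.
  + by case: b => b; rewrite ?bd1_inl ?bd1_inr mul0r.
- rewrite big1 ?add0r => [|b _]; last first.
    by rewrite /cone1 /= !andbF mulr0.
  rewrite big_sumType /= [X in _ + X]big1 ?addr0 => [|b _]; last first.
    by rewrite bd1_inr mulr0.
  under eq_bigr => j _ do rewrite bd1_inr mulrC mulrDl.
  rewrite /base1 /cone1 /=.
  rewrite big_split /= !(sum_ord_pick _ _ (fun j => (l' < j)%N%:R)).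
  have := ltn_ord l => ln; have -> : (l < n)%N by lia.
  have -> : (l.+1 < n)%N by lia.
  rewrite -[inr l' == inr l]/(l' == l :> nat) ltnS.
  by case: (ltngtP l' l) => _; rewrite ?addF2_self ?addr0 ?add0r.
Qed.

End Interval.

(** * Cubes and acyclicity of boxes *)

Section CubeFaces.
Variables (d : nat) (m : 'I_d -> nat).
Implicit Types (c : ecube m) (i j : 'I_d).

Lemma face1P c' c : reflect (forall i, face1 (c' i) (c i)) (face c' c).
Proof. exact: forallP. Qed.

Lemma edimE c : edim c = (\sum_i edge1 (c i))%N.
Proof. by rewrite /edim -sum1_card big_mkcond. Qed.

Definition cadj i c' c : bool :=
  end1 (c' i) (c i) && [forall j, (j != i) ==> (c' j == c j)].

Lemma edim_face c' c : face c' c ->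
  edim c = (edim c' + #|[set i | end1 (c' i) (c i)]|)%N.
Proof.
move/face1P => cc'; rewrite !edimE -sum1dep_card.
rewrite [X in (_ + X)%N]big_mkcond -big_split /=.
apply: eq_bigr => i _; have := cc' i; rewrite face1E /end1.
by case: eqP => [-> _|_ /= /and3P[-> /negbTE-> ->]]; rewrite ?andNb ?andbF ?addn0.
Qed.

(** By [edim_face], a codimension-one face differs from the cube in exactly one coordinate, where an
    edge becomes one of its ends; so at most one summand is nonzero. *)
Lemma facet_cadj c' c : ((facet c' c)%:R : F2) = \sum_i (cadj i c' c)%:R.
Proof.
have [fc | nfc] := boolP (facet c' c).
  have /andP[cc'] := fc.
  rewrite (edim_face cc') -addn1 eqn_add2l => /cards1P[i0 Ei0].
  have endE i : end1 (c' i) (c i) = (i == i0).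
    by have := in_set1 i i0; rewrite -Ei0 inE.
  rewrite (bigD1 i0) //= big1 ?addr0 => [|i ii0].
    rewrite /cadj endE eqxx /=.
    suff -> : [forall j, (j != i0) ==> (c' j == c j)] by [].
    apply/forallP => j; apply/implyP => ji0.
    by have := elimT (face1P _ _) cc' j; rewrite face1E endE (negbTE ji0) orbF.
  by rewrite /cadj endE (negbTE ii0).
rewrite big1 // => i _; have [/andP[ci /forallP cj]|//] := boolP (cadj i c' c).
case/negP: nfc; have cc' : face c' c.
  apply/face1P => j; have [->|ji] := eqVneq j i; first by rewrite face1E ci orbT.
  by rewrite face1E; have := cj j; rewrite ji => /= ->.
rewrite /facet cc' (edim_face cc') -addn1 eqn_add2l; apply/cards1P; exists i.
apply/setP => j; rewrite inE in_set1; have [->|ji] := eqVneq j i; first by [].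
by have := cj j; rewrite ji /= => /eqP ->; rewrite /end1 andNb andbF.
Qed.

Definition upd c i (a : interval (m i)) : ecube m := [ffun j => dfwith c a j].

Lemma upd_in c i a : upd c a i = a.
Proof. by rewrite ffunE dfwith_in. Qed.

Lemma upd_out c i (a : interval (m i)) j : j != i -> upd c a j = c j.
Proof. by move=> ji; rewrite ffunE dfwith_out // eq_sym. Qed.

Lemma upd_id c i : upd c (c i) = c.
Proof.
by apply/ffunP => j; have [->|ji] := eqVneq j i; rewrite ?upd_in ?upd_out.
Qed.

Lemma upd_upd c i (a b : interval (m i)) : upd (upd c a) b = upd c b.
Proof.
by apply/ffunP => j; have [->|ji] := eqVneq j i; rewrite ?upd_in ?upd_out.
Qed.

Lemma updC c i j (a : interval (m i)) (b : interval (m j)) :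
  i != j -> upd (upd c a) b = upd (upd c b) a.
Proof.
move=> ij; apply/ffunP => k; have [->|kj] := eqVneq k j.
  by rewrite upd_in upd_out ?upd_in // eq_sym.
rewrite (upd_out _ _ kj); have [->|ki] := eqVneq k i; first by rewrite !upd_in.
by rewrite !upd_out.
Qed.

Local Notation kernel i := (interval (m i) -> interval (m i) -> F2).
Local Notation cochain := {ffun ecube m -> F2}.

(** Chains of the box are the tensor product of the chains of its sides; this is [K] on the [i]-th
    factor tensored with identities. *)
Definition cube_op i (K : kernel i) (x : cochain) : cochain :=
  [ffun c : ecube m => \sum_a K (c i) a * x (upd c a)].

Lemma cube_op_add i (K : kernel i) x y :
  cube_op K (x + y) = cube_op K x + cube_op K y.
Proof.
apply/ffunP => c; rewrite !ffunE -big_split; apply: eq_bigr => a _ /=.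
by rewrite ffunE mulrDr.
Qed.

Lemma cube_op0 i (K : kernel i) : cube_op K 0 = 0.
Proof. by apply/ffunP => c; rewrite !ffunE big1 // => a _; rewrite ffunE mulr0. Qed.

Lemma cube_op_sum i (K : kernel i) (J : finType) (x : J -> cochain) :
  cube_op K (\sum_j x j) = \sum_j cube_op K (x j).
Proof. by apply: (big_morph _ (@cube_op_add i K)); apply: cube_op0. Qed.

Lemma cube_op_comp i (K L : kernel i) x :
  cube_op K (cube_op L x) = cube_op (fun a' a => \sum_b K a' b * L b a) x.
Proof.
apply/ffunP => c; rewrite !ffunE.
under eq_bigr => a _ do rewrite ffunE mulr_sumr.
rewrite exchange_big /=; apply: eq_bigr => b _; rewrite mulr_suml.
by apply: eq_bigr => a _; rewrite upd_in upd_upd mulrA.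
Qed.

Lemma cube_opC i j (K : kernel i) (L : kernel j) x : i != j ->
  cube_op K (cube_op L x) = cube_op L (cube_op K x).
Proof.
move=> ij; apply/ffunP => c; rewrite !ffunE.
under eq_bigr => a _ do rewrite ffunE mulr_sumr.
rewrite exchange_big /=; apply: eq_bigr => b _; rewrite ffunE mulr_sumr.
apply: eq_bigr => a _; rewrite (upd_out _ _ ij) upd_out; last by rewrite eq_sym.
by rewrite (updC c a b ij) mulrCA.
Qed.

Lemma eq_cube_op i (K L : kernel i) x :
  (forall a' a, K a' a = L a' a) -> cube_op K x = cube_op L x.
Proof.
move=> KL; apply/ffunP => c; rewrite !ffunE.
by apply: eq_bigr => a _; rewrite KL.
Qed.

Lemma cube_op_addl i (K L : kernel i) x :
  cube_op K x + cube_op L x = cube_op (fun a' a => K a' a + L a' a) x.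
Proof.
apply/ffunP => c; rewrite !ffunE -big_split; apply: eq_bigr => a _ /=.
by rewrite mulrDl.
Qed.

Lemma cube_op1 i x : cube_op (i := i) (fun a' a => (a' == a)%:R) x = x.
Proof.
apply/ffunP => c; rewrite ffunE (bigD1 (c i)) //= eqxx mul1r upd_id big1 ?addr0 //.
by move=> a; rewrite eq_sym => /negbTE ->; rewrite mul0r.
Qed.

Definition cube_bdry (x : cochain) : cochain := \sum_i cube_op (i := i) (@bd1 _) x.

Lemma cube_bdryE x c' : cube_bdry x c' = \sum_(c | facet c' c) x c.
Proof.
rewrite big_mkcond /=.
transitivity (\sum_c \sum_i ((cadj i c' c)%:R : F2) * x c).
  rewrite exchange_big sum_ffunE; apply: eq_bigr => i _ /=; rewrite ffunE.
  rewrite [LHS](eq_bigr (fun a =>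
      if end1 (c' i) a then x (upd c' a) else 0)); last first.
    by move=> a _; rewrite /bd1; case: ifP; rewrite ?mul1r ?mul0r.
  rewrite [RHS](eq_bigr (fun c => if cadj i c' c then x c else 0)); last first.
    by move=> c _; case: ifP; rewrite ?mul1r ?mul0r.
  rewrite -!big_mkcond /=.
  rewrite [RHS](reindex_onto (fun a => upd c' a) (fun c => c i)) /=.
    apply: eq_bigl => a; rewrite /cadj upd_in eqxx andbT.
    case: forallP => [_|[]]; rewrite ?andbT // => j; apply/implyP => ji.
    by rewrite upd_out.
  move=> c /andP[_ /forallP cj]; apply/ffunP => j.
  have [->|ji] := eqVneq j i; first by rewrite upd_in.
  by rewrite upd_out //; have := cj j; rewrite ji => /eqP.
apply: eq_bigr => c _; rewrite -mulr_suml -facet_cadj.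
by case: ifP; rewrite ?mul1r ?mul0r.
Qed.

Lemma cube_bdryK x : cube_bdry (cube_bdry x) = 0.
Proof.
rewrite /cube_bdry; under eq_bigr do rewrite cube_op_sum.
apply: sum_sym_F2 => [i|i j ij]; last exact: cube_opC.
rewrite cube_op_comp; apply/ffunP => c; rewrite !ffunE big1 // => a _.
by rewrite bd1K mul0r.
Qed.

(** In each direction an edge has two ends ([bd1_sum]), so every cube contributes an even number of
    faces. *)
Lemma sum_cube_bdry x : \sum_c cube_bdry x c = 0.
Proof.
rewrite /cube_bdry; under eq_bigr do rewrite sum_ffunE.
rewrite exchange_big big1 // => i _ /=.
under eq_bigr do rewrite ffunE.
(* Exchanging a face with its coface makes the coefficient of [x] constant in the inner sum, leaving
   a column sum of [bd1]. *)
pose swap (p : ecube m * interval (m i)) := (upd p.1 p.2, p.1 i).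
have swapK : involutive swap.
  by case=> c a; rewrite /swap /= upd_in upd_upd upd_id.
rewrite pair_big /= (reindex_inj (inv_inj swapK)) /=.
under eq_bigr => p _ do rewrite upd_in upd_upd upd_id.
rewrite -(pair_big predT predT (fun c a => bd1 a (c i) * x c)) /= big1 // => c _.
by rewrite -mulr_suml bd1_sum mul0r.
Qed.

(* Contracting the i-th coordinate to 0 is homotopic to the identity. *)
Lemma cube_homotopy i x :
  cube_bdry (cube_op (i := i) (@cone1 _) x)
    + cube_op (i := i) (@cone1 _) (cube_bdry x)
  = x + cube_op (i := i) (@base1 _) x.
Proof.
rewrite /cube_bdry cube_op_sum -big_split /= (bigD1 i) //=.
rewrite big1 => [|j ji]; last first.
  by rewrite cube_opC // addff_self.
rewrite addr0 !cube_op_comp cube_op_addl.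
rewrite (eq_cube_op _ (@cone1_homotopy (m i))) -cube_op_addl.
by rewrite cube_op1.
Qed.

(** Each direction of [s] is contracted in turn by [cube_homotopy]: the new cycle [p] lies over
    vertex 0 in direction [i], and keeps the earlier vanishing because [base1] alters coordinate [i]
    only. *)
Lemma cube_contract (s : seq 'I_d) x : cube_bdry x = 0 ->
  exists y z, [/\ x = z + cube_bdry y, cube_bdry z = 0 &
    forall c, ~~ all (fun i => ~~ edge1 (c i) && (lo1 (c i) == 0)) s -> z c = 0].
Proof.
move=> bx; elim: s => [|i s [y [z [xE bz z0]]]].
  exists 0, x; split=> //.
  rewrite /cube_bdry big1 ?addr0 // => i _; exact: cube_op0.
pose h := cube_op (i := i) (@cone1 _) z; pose p := cube_op (i := i) (@base1 _) z.
have bhE : cube_bdry h = z + p by rewrite -cube_homotopy bz cube_op0 addr0.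
have bdryD u v : cube_bdry (u + v) = cube_bdry u + cube_bdry v.
  by rewrite /cube_bdry -big_split; apply: eq_bigr => j _; rewrite cube_op_add.
exists (y + h), p; split.
- rewrite bdryD bhE [cube_bdry y + _]addrC addrA addrA.
  rewrite [p + z]addrC -[z + p + p]addrA.
  by rewrite addff_self addr0.
- by have := cube_bdryK h; rewrite bhE bdryD bz add0r.
move=> c /=; rewrite negb_and => cs; rewrite ffunE big1 // => a _.
have [ci|ci] := boolP (~~ edge1 (c i) && (lo1 (c i) == 0)); last first.
  by move: ci; rewrite /base1 andbA andbAC => /negbTE ->; rewrite mul0r.
move: cs; rewrite ci /= => /allPn[j js cj]; rewrite z0 ?mulr0 //.
apply/allPn; exists j => //; rewrite upd_out //.
by apply: contraNneq cj => ->.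
Qed.

End CubeFaces.

(** * Vanishing of the reduced homology of a box *)

Section Box.
Variables (R : realType) (d : nat) (m : 'I_d -> nat) (v : ecube m -> \bar R).

Definition box : fcomplex R := FComplex (@edim d m) (@facet d m) v.

Lemma box_bdryE (x : chain box) : bdry_fun x = cube_bdry x.
Proof. by apply/ffunP => c; rewrite cube_bdryE ffunE. Qed.

Lemma box_complex : (forall c' c : ecube m, face c' c -> (v c' <= v c)%E) ->
  cell_complex box.
Proof.
move=> vmono; split=> [c' c /andP[_ /eqP]|c' c /andP[/vmono]|x] //.
by rewrite !box_bdryE cube_bdryK.
Qed.

Lemma box_augmentation (x : chain box) : \sum_c bdry_fun x c = 0.
Proof. by rewrite box_bdryE; apply: sum_cube_bdry. Qed.

(** Contracting all directions leaves a cycle carried by the origin vertex. It is zero for degree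
    reasons if [j] is not 0, and by the augmentation if [j] is 0. *)
Lemma box_acyclic (j : int) (x : chain box) :
  (forall c : cell box, (cdim c)%:Z != j -> x c = 0) ->
  bdry_fun x = 0 -> (j = 0 -> \sum_c x c = 0) ->
  exists2 y : chain box,
    (forall c : cell box, (cdim c)%:Z != j + 1 -> y c = 0) & x = bdry_fun y.
Proof.
rewrite box_bdryE => xj bx x0.
have [y [z [xE _ z0]]] := cube_contract (enum 'I_d) bx.
(* The contraction ignores degrees, so [y] may be inhomogeneous; only its part in degree [j + 1] has
   boundary in degree [j]. *)
pose y' : chain box := [ffun c : ecube m => if (edim c)%:Z == j + 1 then y c else 0].
have y'j (c : ecube m) : (edim c)%:Z != j + 1 -> y' c = 0.
  by move=> /negbTE cj; rewrite ffunE cj.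
have by'j (c : ecube m) : (edim c)%:Z != j -> bdry_fun y' c = 0.
  move=> cj; rewrite ffunE big1 // => c' /andP[_ /eqP cc']; apply: y'j.
  lia.
have by' (c : ecube m) : (edim c)%:Z == j -> bdry_fun y' c = cube_bdry y c.
  move=> /eqP cj; rewrite cube_bdryE ffunE; apply: eq_bigr => c' /andP[_ /eqP cc'].
  by rewrite ffunE /=; case: eqP => //; lia.
exists y' => //.
pose at0 (c : ecube m) :=
  all (fun i => ~~ edge1 (c i) && (lo1 (c i) == 0)) (enum 'I_d).
pose z' : chain box := x + bdry_fun y'.
have z'j (c : ecube m) : (edim c)%:Z != j -> z' c = 0.
  by move=> cj; rewrite ffunE xj // by'j // addr0.
have z'0 (c : ecube m) : ~~ at0 c ->
    z' c = 0.
  move=> /z0 zc; have [cj|] := boolP ((edim c)%:Z == j); last exact: z'j.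
  by rewrite ffunE by' // xE ffunE zc add0r addF2_self.
have xz' : x = z' + bdry_fun y' by rewrite /z' -addrA addff_self addr0.
suff z'E : z' = 0 by rewrite xz' z'E add0r.
apply/ffunP => c; rewrite [RHS]ffunE; have [cz|] := boolP (at0 c); last exact: z'0.
have c0 (c' : ecube m) : at0 c' ->
    c' = c.
  move=> /allP c'0; move/allP: cz => c0; apply/ffunP => i.
  have := c'0 i; have := c0 i; rewrite mem_enum.
  move=> /(_ isT)/andP[+ /eqP +] /(_ isT)/andP[+ /eqP].
  case: (c' i) (c i) => [a'|a'] [a|a] //= _ a0 _ a'0.
  by congr inl; apply: val_inj; rewrite /= a0.
have [j0|j0] := eqVneq j 0; last first.
  apply: z'j; rewrite eq_sym; apply: contraNneq j0 => ->.
  rewrite /= edimE big1 // => i _; move/allP: cz => /(_ i).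
  by rewrite mem_enum => /(_ isT) /andP[/negbTE ->].
have : \sum_c' z' c' = 0.
  under eq_bigr do rewrite ffunE; rewrite big_split /= x0 // box_augmentation addr0 //.
rewrite (bigD1 c) //= big1 ?addr0 // => c' c'c; apply: z'0.
by apply: contraNN c'c => /c0 ->.
Qed.

End Box.

(** * Duality of ranks *)

Record acyclic (R : realType) (K : fcomplex R) : Prop := Acyclic {
  augmentation_bdry : forall x : chain K, \sum_c bdry_fun x c = 0;
  exact_bdry : forall (j : int) (x : chain K),
    (forall c : cell K, (cdim c)%:Z != j -> x c = 0) ->
    bdry_fun x = 0 -> (j = 0 -> \sum_c x c = 0) ->
    exists2 y : chain K,
      (forall c : cell K, (cdim c)%:Z != j + 1 -> y c = 0) & x = bdry_fun y }.

Section Exactness.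
Variables (R : realType) (K : fcomplex R).
Hypotheses (Kc : cell_complex K) (Ka : acyclic K).

Definition in_dim (j : int) : pred (cell K) := [pred c | (cdim c)%:Z == j].

Definition augmentation (j : int) (x : chain K) : F2 :=
  if j == 0 then \sum_c x c else 0.

Lemma augmentation_is_linear j : linear (augmentation j).
Proof.
move=> a x y; rewrite /augmentation; case: eqP => _; last by rewrite scaler0 addr0.
by rewrite scaler_sumr -big_split; apply: eq_bigr => c _; rewrite !ffunE.
Qed.

HB.instance Definition _ j :=
  GRing.isLinear.Build 'F_2 _ _ _ (augmentation j) (augmentation_is_linear j).

Lemma dim_augmentation j (A : pred (cell K)) :
  \dim (linfun (augmentation j) @: supp_space A) = ((j == 0) && (0 < #|A|)%N).
Proof.
case: (eqVneq j 0) => [-> | j0] /=; last first.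
  apply/eqP; rewrite dimv_eq0 -subv0; apply/subvP => _ /memv_imgP[x _ ->].
  by rewrite lfunE /= /augmentation (negbTE j0) memv0.
have [A0|/card_gt0P[c cA]] := posnP #|A|.
  apply/eqP; rewrite dimv_eq0 -subv0; apply/subvP => _ /memv_imgP[x xA ->].
  suff -> : x = 0 by rewrite linear0 memv0.
  apply/ffunP => c; rewrite ffunE; move/mem_supp_space: xA; apply.
  by rewrite (card0_eq A0).
have -> : (linfun (augmentation 0) @: supp_space A = fullv)%VS.
  apply/vspaceP => a; rewrite memvf; apply/memv_imgP; exists (a *: delta_ffun c).
    apply/memvZ/mem_supp_space => c' c'A; rewrite ffunE.
    by case: eqP c'A => // ->; rewrite cA.
  rewrite lfunE linearZ /= /augmentation eqxx (bigD1 c) //= big1 => [|c' c'c].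
    by rewrite ffunE eqxx addr0 /GRing.scale /= mulr1.
  by rewrite ffunE (negbTE c'c).
by rewrite dimvf.
Qed.

(** A cycle supported on [A], of zero augmentation when [j] is 0, bounds in [K]. Such cycles are
    thus the boundaries of [W], the chains of degree [j + 1] whose boundary lies in [A]; both sides
    are evaluated with [nullity], and the last term is the rank of the augmentation on [A]. *)
Lemma exactness_rank j (A : pred (cell K)) : (forall c, A c -> (cdim c)%:Z = j) ->
  (#|A| + bdry_rank (predC A) (in_dim (j + 1)))%N =
  (bdry_rank predT A + bdry_rank predT (in_dim (j + 1))
   + ((j == 0%R) && (0 < #|A|)%N))%N.
Proof.
move=> Aj; pose ker := (bdry K @^-1: supp_space (predC predT))%VS.
pose W := (supp_space (in_dim (j + 1)) :&:
  bdry K @^-1: supp_space (predC (predC A)))%VS.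
have kerP x : reflect (bdry_fun x = 0) (x \in ker).
  rewrite -memv_preim bdryE; apply: (iffP (mem_supp_space _ _)) => [x0|-> c].
    by apply/ffunP => c; rewrite x0 // ffunE.
  by rewrite ffunE.
have kerE : ker = lker (bdry K).
  apply/vspaceP => x; rewrite memv_ker bdryE.
  by apply/kerP/eqP.
have kerA : (supp_space A :&: ker :&: lker (linfun (augmentation j)) =
    bdry K @: W)%VS.
  apply/vspaceP => x; rewrite !memv_cap memv_ker lfunE /=.
  apply/idP/memv_imgP => [/andP[/andP[/mem_supp_space xA /kerP bx] /eqP ax]|[y]].
    have [||y yj xE] := @exact_bdry R K Ka j x _ bx _.
    - by move=> c cj; apply: xA; apply: contraNN cj => /Aj ->.
    - by move=> j0; move: ax; rewrite /augmentation j0.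
    exists y; last by rewrite bdryE.
    rewrite memv_cap; apply/andP; split; first by apply/mem_supp_space.
    rewrite -memv_preim bdryE -xE; apply/mem_supp_space => c.
    by rewrite !inE negbK; apply: xA.
  rewrite memv_cap -memv_preim bdryE => /andP[_ /mem_supp_space bA] ->.
  apply/andP; split; first (apply/andP; split).
  - by apply/mem_supp_space => c cA; apply: bA; rewrite !inE negbK.
  - by apply/kerP; rewrite bdry_funK.
  - by rewrite /augmentation (augmentation_bdry Ka) if_same.
have := nullity predT A; have := nullity predT (in_dim (j + 1)).
have := nullity (predC A) (in_dim (j + 1)).
have := limg_ker_dim (linfun (augmentation j)) (supp_space A :&: ker).
have := limg_ker_dim (bdry K) W; rewrite kerA -/W -/ker.
have -> : (W :&: lker (bdry K) = supp_space (in_dim (j + 1)) :&: ker)%VS.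
  apply/vspaceP => x; rewrite kerE !memv_cap; case: (x \in supp_space _) => //=.
  rewrite memv_ker; case: eqP => [bx|]; rewrite ?andbF // andbT -memv_preim bx.
  by rewrite mem0v.
have -> : \dim (linfun (augmentation j) @: (supp_space A :&: ker)) =
          ((j == 0) && (0 < #|A|)%N).
  case: (eqVneq j 0) => [j0|/negbTE j0]; last first.
    apply/eqP; rewrite dimv_eq0 -subv0; apply/subvP => _ /memv_imgP[x _ ->].
    by rewrite lfunE /= /augmentation j0 memv0.
  rewrite (_ : _ :&: _ = supp_space A)%VS.
    by rewrite dim_augmentation j0 eqxx.
  apply/capv_idPl/subvP => x /mem_supp_space xA; apply/kerP.
  apply/ffunP => c; rewrite !ffunE big1 // => c' cc'; apply: xA.
  by apply/negP => /Aj; rewrite (cfacet_dim Kc cc') j0.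
have arith (D dv w u h nA f g e n : nat) : (D + dv = w -> dv + e = u -> w + f = n ->
    D + g = n -> u + h = nA -> nA + f = h + g + e)%N by lia.
exact: arith.
Qed.

End Exactness.

(* The common pattern of the two dualities between the V- and T-constructions; *)
(* K is the complex of the padded image. *)
Record complement_dual (R : realType) (X K : fcomplex R) (d : nat)
    (dl : cell X -> cell K) : Prop := ComplementDual {
  dl_inj : injective dl;
  dl_dim : forall c, (cdim (dl c) + cdim c)%N = d;
  dl_facet : forall c c', cfacet (dl c) (dl c') = cfacet c' c;
  dl_val : forall c, cval (dl c) = (- cval c)%E;
  dl_codom : forall c, c \notin codom dl -> cval c = -oo%E;
  vertex_notin_dl : exists2 c : cell K, cdim c = 0%N & c \notin codom dl }.

Section Duality.
Variables (R : realType) (X K : fcomplex R) (d : nat) (dl : cell X -> cell K).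
Hypotheses (Xc : cell_complex X) (Kc : cell_complex K) (Ka : acyclic K).
Hypothesis dlD : complement_dual d dl.

(** [dl] turns [<= r] into [>= -r], while the complement of a sublevel set is strict; avoiding the
    cell values reconciles the two. Both ranks then come from [rank_hmap], and three instances of
    [exactness_rank] trade the blocks for their complements. *)
Lemma duality_rank (k : int) (r s : R) : r <= s ->
  (forall c : cell X, cval c != r%:E) -> (forall c : cell X, cval c != s%:E) ->
  let j := d%:Z - k - 1 in
  \dim (limg (linfun (@hmap R K j (- s)%:E (- r)%:E))) =
  (\dim (limg (linfun (@hmap R X k r%:E s%:E))) + (j == 0))%N.
Proof.
move=> rs nr ns j.
have [dl_inj dl_dim dl_facet dl_val dl_codom vertex_notin] := dlD.
have jE : j = d%:Z - k - 1 by []; clearbody j.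
have nrs : ((- s)%:E <= (- r)%:E)%E by rewrite lee_fin lerN2.
(* [a] and [b] are the cells outside [K_{-r}] in degree [j + 1] and outside [K_{-s}] in degree [j]:
   the duals of the [k]-cells of [X_r] and of the [(k + 1)]-cells of [X_s]. *)
pose a : pred (cell K) := [pred c | ((cdim c)%:Z == j + 1) && ((- r)%:E < cval c)%E].
pose b : pred (cell K) := [pred c | ((cdim c)%:Z == j) && ((- s)%:E < cval c)%E].
have val_codom (t : R) c : (t%:E < cval c)%E -> c \in codom dl.
  by apply: contraTT => /dl_codom ->; rewrite -leNgt leNye.
have levE (i : int) (t : R) c : (forall c : cell X, cval c != t%:E) ->
    level i t%:E c = ((cdim (dl c))%:Z == d%:Z - i) && ((- t)%:E < cval (dl c))%E.
  move=> nt; rewrite /level /= -(dl_dim c) dl_val EFinN lteN2 lt_neqAle nt /=.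
  by congr (_ && _); lia.
have aE c : level k r%:E c = a (dl c).
  by rewrite levE // /a /b /= jE; congr (_ && _); lia.
have bE c : level (k + 1) s%:E c = b (dl c).
  by rewrite levE // /a /b /= jE; congr (_ && _); lia.
(* Values grow along cofaces, so no nonzero entry in these rows leaves the image of [dl], as
   [rel_rank_inj] requires. *)
have cofaces (t : R) (P : pred (cell K)) : (forall c, P c -> (t%:E < cval c)%E) ->
    forall c c', P c && cfacet c c' -> c \in codom dl /\ c' \in codom dl.
  move=> Pt c c' /andP[/Pt tc cc']; split; first exact: val_codom tc.
  exact: val_codom (lt_le_trans tc (cfacet_val Kc cc')).
have at_ c : a c -> ((- r)%:E < cval c)%E by case/andP.
have bt_ c : b c -> ((- s)%:E < cval c)%E by case/andP.
have rk_a : bdry_rank predT (level (X := X) k r%:E) = bdry_rank a predT.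
  rewrite /bdry_rank -rel_rank_tr; apply: (rel_rank_inj dl_inj dl_inj) => [c c'|].
    by rewrite /= aE dl_facet.
  exact: cofaces at_.
have rk_b : bdry_rank predT (level (X := X) (k + 1) s%:E) = bdry_rank b predT.
  rewrite /bdry_rank -rel_rank_tr; apply: (rel_rank_inj dl_inj dl_inj) => [c c'|].
    by rewrite /= bE dl_facet.
  exact: cofaces bt_.
have rk_ab :
    bdry_rank (predC (level (X := X) k r%:E)) (level (X := X) (k + 1) s%:E) =
    bdry_rank b (predC a).
  rewrite /bdry_rank -rel_rank_tr; apply: (rel_rank_inj dl_inj dl_inj) => [c c'|].
    by rewrite [predC _ _]/= aE bE dl_facet andbCA.
  move=> c c' /and3P[bc _ cc']; apply: (cofaces _ _ bt_); exact/andP.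
have card_a : #|level (X := X) k r%:E| = #|a|.
  rewrite -(card_image dl_inj); apply: eq_card => c; apply/imageP/idP.
    by case=> c0; rewrite ![_ \in _]aE => ac0 ->.
  move=> ac; have /codomP[c0 cE] := val_codom _ _ (at_ _ ac).
  by exists c0 => //; rewrite [_ \in _]aE -cE.
have card_dim : #|in_dim (K := K) (j + 1)| =
    (#|a| + #|level (X := K) (j + 1) (- r)%:E|)%N.
  rewrite -(cardID a); congr (_ + _)%N; apply: eq_card => c; rewrite !inE.
    by case: (_ == _).
  by rewrite leNgt; case: (_ == _); rewrite ?andbF ?andbT.
(* The vertex missed by [dl] has value -oo, so every sublevel set of [K] is nonempty. *)
have E0 : ((j == 0) && (0 < #|level (X := K) j (- s)%:E|)%N) = (j == 0).
  case: eqP => //= j0; apply/card_gt0P; have [c c0 cdl] := vertex_notin.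
  by exists c; rewrite !inE c0 j0 dl_codom ?leNye.
have E1 : ((j + 1 == 0) && (0 < #|level (X := K) (j + 1) (- r)%:E|)%N) =
          ((j + 1 == 0) && (0 < #|in_dim (K := K) (j + 1)|)%N).
  case: eqP => //= j0; have [c c0 cdl] := vertex_notin.
  transitivity true; [|symmetry]; apply/card_gt0P; exists c; rewrite !inE c0 j0 //.
  by rewrite dl_codom ?leNye.
have dim_facet (i : int) (c c' : cell K) : cfacet c c' ->
    ((cdim c')%:Z == i + 1) = ((cdim c)%:Z == i).
  by move=> /(cfacet_dim Kc) ->; lia.
have ex0 := @exactness_rank R K Kc Ka j (level (X := K) j (- s)%:E).
have ex1 := @exactness_rank R K Kc Ka (j + 1) (level (X := K) (j + 1) (- r)%:E).
have ex2 := @exactness_rank R K Kc Ka (j + 1) (in_dim (K := K) (j + 1)).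
have rk0 : bdry_rank (predC (level (X := K) j (- s)%:E)) (in_dim (K := K) (j + 1)) =
    bdry_rank b predT.
  apply: eq_rel_rank => c c' /=; case cc': (cfacet c c'); rewrite ?andbF // !andbT.
  rewrite /level /in_dim /a /b /=.
  by rewrite (dim_facet j _ _ cc') ltNge; case: (_ == _); rewrite ?andbT ?andbF.
have rk1 : bdry_rank (predC (level (X := K) (j + 1) (- r)%:E))
    (in_dim (K := K) (j + 1 + 1)) = bdry_rank a predT.
  apply: eq_rel_rank => c c' /=; case cc': (cfacet c c'); rewrite ?andbF // !andbT.
  rewrite /level /in_dim /a /b /=.
  by rewrite (dim_facet (j + 1) _ _ cc') ltNge; case: (_ == _); rewrite ?andbT ?andbF.
have rk2 : bdry_rank (predC (in_dim (K := K) (j + 1)))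
    (in_dim (K := K) (j + 1 + 1)) = 0%N.
  apply: rel_rank0 => c c' /=; case cc': (cfacet c c'); rewrite ?andbF // !andbT.
  rewrite /level /in_dim /a /b /=.
  by rewrite (dim_facet (j + 1) _ _ cc') andNb.
have rk3 : bdry_rank (predC (level (X := K) j (- s)%:E))
    (level (X := K) (j + 1) (- r)%:E) =
           bdry_rank b (predC a).
  apply: eq_rel_rank => c c' /=; case cc': (cfacet c c'); rewrite ?andbF // !andbT.
  rewrite /level /a /b /= (dim_facet j _ _ cc') !ltNge.
  by case: (_ == _); rewrite //= negbK.
have := rank_hmap Xc k (_ : r%:E <= s%:E)%E; rewrite lee_fin => /(_ rs).
have := rank_hmap Kc j nrs.
rewrite E0 rk0 in ex0; rewrite E1 rk1 in ex1; rewrite rk2 in ex2.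
rewrite rk3 rk_a rk_b rk_ab card_a.
have {}ex0 := ex0 (fun c => (fun h => eqP (proj1 (andP h)))).
have {}ex1 := ex1 (fun c => (fun h => eqP (proj1 (andP h)))).
have {}ex2 := ex2 (fun c => (fun h => eqP h)).
lia.
Qed.

End Duality.

(** * The complexes of an image *)

Section DualCubes.
Variables (d : nat) (m m' : 'I_d -> nat).
Variable delta : forall i, interval (m i) -> interval (m' i).
Hypothesis delta_edge : forall i a, edge1 (@delta i a) = ~~ edge1 a.
Hypothesis delta_face : forall i a a', face1 (@delta i a) (delta a') = face1 a' a.

Definition dual_cube (c : ecube m) : ecube m' := [ffun i => delta (c i)].

Lemma face_dual_cube c c' : face (dual_cube c) (dual_cube c') = face c' c.
Proof. by apply: eq_forallb => i; rewrite /lo /hi !ffunE; apply: delta_face. Qed.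

Lemma delta_inj i : injective (@delta i).
Proof.
move=> a a' aa'.
have aa : face1 a' a by rewrite -delta_face aa' face1E eqxx.
have : face1 a a' by rewrite -delta_face aa' face1E eqxx.
move: aa; rewrite !face1E /end1 eq_sym; case: eqP => //= _.
by case/and3P=> _ _ ->; rewrite andbF.
Qed.

Lemma dual_cube_inj : injective dual_cube.
Proof.
move=> c c' /ffunP cc'; apply/ffunP => i; apply: delta_inj.
by have := cc' i; rewrite !ffunE.
Qed.

Lemma edim_dual_cube c : (edim (dual_cube c) + edim c)%N = d.
Proof.
rewrite !edimE -big_split /= -[RHS]card_ord -sum1_card; apply: eq_bigr => i _.
by rewrite ffunE delta_edge; case: edge1.
Qed.

Lemma facet_dual_cube c c' : facet (dual_cube c) (dual_cube c') = facet c' c.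
Proof.
rewrite /facet face_dual_cube; congr (_ && _).
have := edim_dual_cube c; have := edim_dual_cube c'; lia.
Qed.

Lemma notin_dual_cube c : c \notin codom dual_cube ->
  exists i, c i \notin codom (@delta i).
Proof.
move=> cdl; apply/existsP; apply: contraNT cdl; rewrite negb_exists => /forallP ci.
have cdelta i : c i \in codom (@delta i) by have := ci i; rewrite negbK.
apply/codomP; exists [ffun i => iinv (cdelta i)].
by apply/ffunP => i; rewrite !ffunE f_iinv.
Qed.

Lemma origin_notin_dual_cube (i : 'I_d) (c : ecube m') :
  (forall a, delta a != c i) -> c \notin codom dual_cube.
Proof.
by move=> ci; apply/codomP => -[c' cE]; have := ci (c' i); rewrite cE ffunE eqxx.
Qed.

End DualCubes.

(** * Dual cells in one dimension *)

Section IntervalDuals.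
Variable n : nat.

(* Pixel j of an image is pixel j + 1 of the padded image. *)
Definition dualVT (a : 'I_n + 'I_n.-1) : 'I_n.+3 + 'I_n.+2 :=
  match a with inl j => inr (inord j.+1) | inr l => inl (inord l.+2) end.

(** Point [j] separates pixels [j - 1] and [j], which are the vertices [j] and [j + 1] of the padded
    image; hence the edge [[j, j + 1]]. *)
Definition dualTV (a : 'I_n.+1 + 'I_n) : 'I_n.+2 + 'I_n.+1 :=
  match a with inl j => inr (inord j) | inr l => inl (inord l.+1) end.

Lemma dualVT_edge a : edge1 (n := n.+3) (dualVT a) = ~~ edge1 a.
Proof. by case: a. Qed.

Lemma dualTV_edge a : edge1 (n := n.+2) (dualTV a) = ~~ edge1 (n := n.+1) a.
Proof. by case: a. Qed.

Lemma dualVT_face a a' : face1 (n := n.+3) (dualVT a) (dualVT a') = face1 a' a.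
Proof.
case: a a' => [j|j] [j'|j']; have jn := ltn_ord j; have j'n := ltn_ord j';
  rewrite /face1 /= !inordK; lia.
Qed.

Lemma dualTV_face a a' :
  face1 (n := n.+2) (dualTV a) (dualTV a') = face1 (n := n.+1) a' a.
Proof.
case: a a' => [j|j] [j'|j']; have jn := ltn_ord j; have j'n := ltn_ord j';
  rewrite /face1 /= !inordK; lia.
Qed.

Lemma notin_dualVT (a : 'I_n.+3 + 'I_n.+2) : a \notin codom dualVT ->
  match a with
  | inl j => (j <= 1)%N || (n < j)%N
  | inr l => (l == 0 :> nat) || (n < l)%N
  end.
Proof.
apply: contraNT; case: a => [j|l]; rewrite negb_or -leqNgt.
  rewrite -ltnNge => /andP[j1 jn]; have jn2 : (j.-2 < n.-1)%N by lia.
  apply/codomP; exists (inr (Ordinal jn2)); congr inl; apply: val_inj => /=.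
  by rewrite inordK; lia.
move=> /andP[l0 ln]; have ln1 : (l.-1 < n)%N by lia.
apply/codomP; exists (inl (Ordinal ln1)); congr inr; apply: val_inj => /=.
by rewrite inordK; lia.
Qed.

Lemma notin_dualTV (a : 'I_n.+2 + 'I_n.+1) : a \notin codom dualTV ->
  if a is inl j then (j == 0 :> nat) || (n < j)%N else false.
Proof.
apply: contraNT; case: a => [j|l].
  rewrite negb_or -leqNgt => /andP[j0 jn]; have jn1 : (j.-1 < n)%N by lia.
  apply/codomP; exists (inr (Ordinal jn1)); congr inl; apply: val_inj => /=.
  by rewrite inordK; lia.
move=> _; apply/codomP; exists (inl l); congr inr; apply: val_inj => /=.
by rewrite inordK.
Qed.

End IntervalDuals.

(** * Values on dual cells and on border cells *)

Section Images.
Variables (R : realType) (d : nat).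

Lemma face_trans (m : 'I_d -> nat) (c1 c2 c3 : ecube m) :
  face c1 c2 -> face c2 c3 -> face c1 c3.
Proof.
move=> /forallP c12 /forallP c23; apply/forallP => i.
by move: (c12 i) (c23 i); lia.
Qed.

Lemma Vcomplex_complex (m : 'I_d -> nat) (J : pixel m -> \bar R) :
  cell_complex (Vcomplex J).
Proof.
apply: box_complex => c' c cc'; apply: bigmax_le; first exact: leNye.
by move=> p pc'; apply: le_bigmax_cond; apply: face_trans cc'.
Qed.

Lemma Tcomplex_complex (m : 'I_d -> nat) (J : pixel m -> \bar R) :
  cell_complex (Tcomplex J).
Proof.
apply: box_complex => c' c cc'; apply: le_bigmin; first exact: leey.
by move=> p pc; apply: bigmin_le_cond; apply: face_trans pc.
Qed.

Lemma Vcomplex_acyclic (m : 'I_d -> nat) (J : pixel m -> \bar R) :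
  acyclic (Vcomplex J).
Proof. split; [exact: box_augmentation | exact: box_acyclic]. Qed.

Lemma Tcomplex_acyclic (m : 'I_d -> nat) (J : pixel m -> \bar R) :
  acyclic (Tcomplex J).
Proof. split; [exact: box_augmentation | exact: box_acyclic]. Qed.

Variables (n : 'I_d -> nat) (I : pixel n -> R).

Definition shift (q : pixel n) : pixel (fun i => (n i).+2) :=
  [ffun i => inord (q i).+1].

Lemma shiftE q i : shift q i = (q i).+1 :> nat.
Proof. by rewrite ffunE inordK // ltnS ltnW // ltnS. Qed.

Lemma neg_padded_shift q : neg_padded I (shift q) = (- (I q)%:E)%E.
Proof.
rewrite /neg_padded /padded; case: pickP => [q' /forallP q'E|/(_ q)/negP[]].
  congr (- (I _)%:E)%E; apply/ffunP => i; apply: val_inj; apply: succn_inj.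
  by rewrite -(shiftE q); apply/esym/eqP.
by apply/forallP => i; rewrite shiftE.
Qed.

Lemma neg_padded_border (p : pixel (fun i => (n i).+2)) i :
  (p i == 0 :> nat) || (n i < p i)%N ->
  neg_padded I p = -oo%E.
Proof.
rewrite /neg_padded /padded; case: pickP => // q /forallP/(_ i)/eqP ->.
by have := ltn_ord (q i); lia.
Qed.

Lemma pixel_shift (p : pixel (fun i => (n i).+2)) :
  (forall i, (0 < p i <= n i)%N) -> exists q, p = shift q.
Proof.
move=> pn; have pn1 i : ((p i).-1 < n i)%N by have := pn i; lia.
exists [ffun i => Ordinal (pn1 i)]; apply/ffunP => i; apply: val_inj.
by rewrite /= shiftE ffunE /= prednK //; case/andP: (pn i).
Qed.

Lemma pixel_shiftP (p : pixel (fun i => (n i).+2)) :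
  (exists q, p = shift q) \/ neg_padded I p = -oo%E.
Proof.
have [/forallP pn|] := boolP [forall i, (0 < p i <= n i)%N].
  by left; apply: pixel_shift.
rewrite negb_forall => /existsP[i pi]; right; apply: (@neg_padded_border _ i).
by move: pi; lia.
Qed.

Definition dual_VT : ecube n -> ecube (fun i => (n i).+3) :=
  dual_cube (fun i => @dualVT (n i)).

Definition dual_TV : ecube (fun i => (n i).+1) -> ecube (fun i => (n i).+2) :=
  dual_cube (fun i => @dualTV (n i)).

Lemma dual_VT_vertex q : dual_VT (vertex_of q) = cube_of (shift q).
Proof. by apply/ffunP => i; rewrite !ffunE. Qed.

Lemma dual_TV_cube q : dual_TV (cube_of q) = vertex_of (shift q).
Proof. by apply/ffunP => i; rewrite !ffunE. Qed.

(** Negation turns the maximum into a minimum over the same pixels: every cube around a dual cell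
    belongs to a shifted pixel, never to the border. *)
Lemma cval_dual_VT c :
  cval (f := Tcomplex (neg_padded I)) (dual_VT c) =
  (- cval (f := Vcomplex (ext_image I)) c)%E.
Proof.
rewrite /= (big_morph (-%E)%E (@oppe_max R) (erefl _)).
have faceE q : face (dual_VT c) (cube_of (shift q)) = face (vertex_of q) c.
  by rewrite -dual_VT_vertex face_dual_cube // => i a a'; exact: dualVT_face.
apply/le_anti/andP; split; apply: le_bigmin => [|p cp]; rewrite ?leey //.
  by rewrite -[(- _)%E]neg_padded_shift; apply: bigmin_le_cond; rewrite faceE.
have [|q pE] := @pixel_shift p.
  move=> i; have := forallP cp i; rewrite /lo /hi !ffunE.
  by case: (c i) => l /=; rewrite inordK; have := ltn_ord l; lia.
rewrite pE neg_padded_shift; apply: bigmin_le_cond.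
by rewrite -faceE -pE.
Qed.

(** Here a dual cell may have border vertices, but their value -oo does not affect the maximum. *)
Lemma cval_dual_TV c :
  cval (f := Vcomplex (neg_padded I)) (dual_TV c) =
  (- cval (f := Tcomplex (ext_image I)) c)%E.
Proof.
rewrite /= (big_morph (-%E)%E (@oppe_min R) (erefl _)).
have faceE q : face (vertex_of (shift q)) (dual_TV c) = face c (cube_of q).
  by rewrite -dual_TV_cube face_dual_cube // => i a a'; exact: dualTV_face.
apply/le_anti/andP; split; apply: bigmax_le => [|p cp]; rewrite ?leNye //.
  have [[q pE]|->] := pixel_shiftP p; last exact: leNye.
  rewrite pE neg_padded_shift; apply: (le_bigmax_cond _ (fun q => - (I q)%:E)%E).
  by rewrite -faceE -pE.
by rewrite -[(- _)%E]neg_padded_shift; apply: le_bigmax_cond; rewrite faceE.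
Qed.

Lemma cval_notin_dual_VT c : (forall i, 0 < n i)%N -> c \notin codom dual_VT ->
  cval (f := Tcomplex (neg_padded I)) c = -oo%E.
Proof.
move=> n0 /notin_dual_cube[i ci]; apply/le_anti; rewrite leNye andbT.
(* A border pixel whose cube contains [c]: at a point [k] the interval to its left is taken (to its
   right for [k = 0]), and the last one when [k] exceeds [n i]. In a direction where [c] is not dual
   this gives border index 0 or [n i + 1]. *)
pose p : pixel (fun i => (n i).+2) := [ffun i => inord
  match c i with inl j => if (j <= n i)%N then j.-1 else (n i).+1 | inr l => l end].
have pE j : p j = match c j with inl k => if (k <= n j)%N then k.-1 else (n j).+1
                                | inr l => l end :> nat.
  rewrite ffunE inordK //; case: (c j) => [k|l] /=; last exact: ltn_ord.
  by case: ifP; lia.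
apply: (@bigmin_inf _ _ _ _ p).
  apply/forallP => j; rewrite /lo /hi ffunE pE; case: (c j) => [k|l] /=.
    by have := ltn_ord k; case: ifP; lia.
  by rewrite !leqnn.
rewrite (@neg_padded_border _ i) // pE.
have := notin_dualVT ci; have := n0 i; case: (c i) => [k|l] //=.
by case: ifP; lia.
Qed.

(** In some direction [c] is a point on the border layer, so all its vertices have value -oo. *)
Lemma cval_notin_dual_TV c : c \notin codom dual_TV ->
  cval (f := Vcomplex (neg_padded I)) c = -oo%E.
Proof.
move=> /notin_dual_cube[i ci]; apply/le_anti; rewrite leNye andbT.
apply: bigmax_le => // p /forallP/(_ i); rewrite /lo /hi ffunE.
have := notin_dualTV ci; case: (c i) => [k|l] //= ki pk.
rewrite (@neg_padded_border _ i) // (_ : p i = k :> nat) //.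
by apply/eqP; rewrite eqn_leq andbC.
Qed.

End Images.

(** * Barcodes *)

Section Bars.
Variable R : realType.
Implicit Types (M : seq (\bar R)) (x y : \bar R) (r s t u : R) (A : seq (bar R)).

(** A real threshold just above [x], with no point of [M] in between; [x] may be -oo. *)
Lemma cut_after M x : (x < +oo)%E ->
  exists2 r, (x < r%:E)%E & forall y, y \in M -> (y <= x)%E \/ (r%:E < y)%E.
Proof.
move=> xy; elim: M => [|y M [r xr rM]].
  case: x xy => [x _| // | _]; last by exists 0; rewrite ?ltNyr.
  by exists (x + 1); rewrite ?lte_fin ?ltrDl.
have [yx|xy'] := leP y x.
  by exists r => // z; rewrite inE => /predU1P[->|/rM //]; left.
have [ry|yr] := ltP r%:E y.
  by exists r => // z; rewrite inE => /predU1P[->|/rM //]; right.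
have [t xt ty] : exists2 t, (x < t%:E)%E & (t%:E < y)%E.
  case: y xy' yr => [y xy' _|_|]; last 2 first.
  - by rewrite leye_eq.
  - by rewrite ltNge leNye.
  case: x xy' {xy xr rM} => [x||_]; last 2 first.
  - by rewrite ltNge leey.
  - by exists (y - 1); rewrite ?ltNyr // lte_fin ltrBlDr ltrDl.
  by rewrite lte_fin => /midf_lt[? ?]; exists ((x + y) / 2%:R); rewrite lte_fin.
exists t => // z; rewrite inE => /predU1P[->|/rM[|rz]]; [by right|by left|right].
exact: lt_trans ty (le_lt_trans yr rz).
Qed.

Lemma cut_before M x : (-oo < x)%E ->
  exists2 r, (r%:E < x)%E & forall y, y \in M -> (x <= y)%E \/ (y < r%:E)%E.
Proof.
rewrite -lteN2 => /(cut_after (map -%E M)%E)[r xr rM]; exists (- r).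
  by rewrite EFinN lteNl.
move=> y /(map_f -%E)%E/rM; rewrite leeN2 EFinN => -[|]; [by left|right].
by rewrite lteNr.
Qed.

Definition count_bars A r s : nat :=
  count (fun b : bar R => (b.1 <= r%:E)%E && (s%:E < b.2)%E) A.

Lemma count_mem_bar A (b1 b2 : \bar R) :
  (count_mem (b1, b2) A + count (fun b => (b.1 < b1)%E && (b2 <= b.2)%E) A
     + count (fun b => (b.1 <= b1)%E && (b2 < b.2)%E) A)%N =
  (count (fun b => (b.1 <= b1)%E && (b2 <= b.2)%E) A
     + count (fun b => (b.1 < b1)%E && (b2 < b.2)%E) A)%N.
Proof.
elim: A => //= -[x y] A; rewrite /= xpair_eqE.
by case: ltgtP => _; case: ltgtP => _ /=; lia.
Qed.

(* Off a finite set of values, the counts determine the multiplicities by *)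
(* inclusion-exclusion at cuts just before and just after both end points. *)
Lemma count_bars_perm A A' (L : seq R) :
  all (fun b : bar R => (b.1 < b.2)%E) A ->
  all (fun b : bar R => (b.1 < b.2)%E) A' ->
  (forall r s, r <= s -> r \notin L -> s \notin L ->
     count_bars A r s = count_bars A' r s) ->
  perm_eq A A'.
Proof.
move=> Ab A'b cnt; apply/allP => -[b1 b2] bAA' /=.
have b12 : (b1 < b2)%E.
  by move: bAA'; rewrite mem_cat => /orP[/(allP Ab)|/(allP A'b)].
(* Cuts are taken relative to the end points and to [L], so that the thresholds avoid [L]. *)
pose M := map EFin L ++ (map fst (A ++ A') ++ map snd (A ++ A')).
have M1 b : b \in A ++ A' -> b.1 \in M.
  by move=> bA; rewrite !mem_cat map_f ?orbT // -mem_cat.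
have M2 b : b \in A ++ A' -> b.2 \in M.
  by move=> bA; rewrite !mem_cat (map_f snd) ?orbT // -mem_cat.
have cut_count r s : (forall y, y \in M -> (y <= b1)%E \/ (r%:E < y)%E) ->
    (forall y, y \in M -> (y != r%:E)) -> (forall y, y \in M -> (y != s%:E)) ->
    (forall y, y \in M -> (b2 <= y)%E \/ (y <= s%:E)%E) ->
    count_bars A r s = count_bars A' r s.
  (* The cut [s] before [b2] may fall below the cut [r] after [b1]. Raising it to the maximum
     crosses no point of [M], hence changes no count. *)
  move=> Mr rM sM Ms; pose t := Num.max r s.
  have tE y : y \in M -> (t%:E < y)%E = (s%:E < y)%E.
    move=> yM; rewrite /t; case: (leP r s) => // sr; apply/idP/idP => [|sy].
      by apply: lt_trans; rewrite lte_fin.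
    have [yb1|//] := Mr y yM; have [b2y|ys] := Ms y yM.
      by have := lt_le_trans b12 (le_trans b2y yb1); rewrite ltxx.
    by have := lt_le_trans sy ys; rewrite ltxx.
  have notL u : (forall y, y \in M -> (y != u%:E)) -> u \notin L.
    move=> uM; apply/negP => uL.
    by have /uM : u%:E \in M; rewrite ?eqxx // mem_cat map_f.
  have tM : forall y, y \in M -> (y != t%:E) by rewrite /t; case: (leP r s).
  have countE C : {subset C <= A ++ A'} -> count_bars C r s = count_bars C r t.
    by move=> CA; apply: eq_in_count => b /CA/M2/tE ->.
  rewrite !countE => [|b bA|b bA]; rewrite ?mem_cat ?bA ?orbT //.
  by apply: cnt; rewrite ?notL // /t le_max lexx.
have [r1 r1b Mr1] : exists2 r, (b1 < r%:E)%E &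
    forall y, y \in M -> (y <= b1)%E \/ (r%:E < y)%E.
  by apply: cut_after; apply: lt_le_trans b12 (leey _).
have [s1 s1b Ms1] : exists2 r, (r%:E < b2)%E &
    forall y, y \in M -> (b2 <= y)%E \/ (y < r%:E)%E.
  by apply: cut_before; apply: le_lt_trans (leNye _) b12.
have off r b : (b < r%:E)%E -> (forall y, y \in M -> (y <= b)%E \/ (r%:E < y)%E) ->
    forall y, y \in M -> y != r%:E.
  move=> br Mr y /Mr[yb|ry]; first by rewrite lt_eqF // (le_lt_trans yb).
  by rewrite gt_eqF.
have off' r b : (r%:E < b)%E -> (forall y, y \in M -> (b <= y)%E \/ (y < r%:E)%E) ->
    forall y, y \in M -> y != r%:E.
  move=> br Mr y /Mr[yb|ry]; last by rewrite lt_eqF.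
  by rewrite gt_eqF // (lt_le_trans br).
have le1 r b y : (b < r%:E)%E -> (forall y, y \in M -> (y <= b)%E \/ (r%:E < y)%E) ->
    y \in M -> (y <= b)%E = (y <= r%:E)%E.
  move=> br Mr /Mr[yb|ry]; first by rewrite yb (le_trans yb) // ltW.
  by rewrite !leNgt ry (lt_trans br).
have lt1 r b y : (r%:E < b)%E -> (forall y, y \in M -> (b <= y)%E \/ (y < r%:E)%E) ->
    y \in M -> (y < b)%E = (y <= r%:E)%E.
  move=> rb Mr /Mr[yb|yr]; last by rewrite (lt_trans yr rb) ltW.
  by rewrite ltNge yb leNgt (lt_le_trans rb yb).
have cnt11 : count (fun b => (b.1 <= b1)%E && (b2 <= b.2)%E) A =
             count (fun b => (b.1 <= b1)%E && (b2 <= b.2)%E) A'.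
  have e C : {subset C <= A ++ A'} ->
      count (fun b => (b.1 <= b1)%E && (b2 <= b.2)%E) C = count_bars C r1 s1.
    move=> CA; apply: eq_in_count => b /CA bA.
    by rewrite (le1 r1 b1) ?M1 // [(b2 <= _)%E]leNgt (lt1 s1 b2) ?M2 // -ltNge.
  rewrite !e => [|b bA|b bA]; rewrite ?mem_cat ?bA ?orbT //.
  apply: cut_count => //; [exact: off r1b Mr1|exact: off' s1b Ms1|].
  by move=> y /Ms1[|/ltW]; [left|right].
have cnt10 : count (fun b => (b.1 <= b1)%E && (b2 < b.2)%E) A =
             count (fun b => (b.1 <= b1)%E && (b2 < b.2)%E) A'.
  (* There is no cut after +oo, but no bar ends later, so both counts vanish. *)
  have [->|b2y] := eqVneq b2 +oo%E.
    by rewrite !(eq_count (a2 := pred0)) ?count_pred0 // => b /=;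
      rewrite ltNge leey andbF.
  have [s0 s0b Ms0] : exists2 r, (b2 < r%:E)%E &
      forall y, y \in M -> (y <= b2)%E \/ (r%:E < y)%E.
    by apply: cut_after; rewrite ltey.
  have e C : {subset C <= A ++ A'} ->
      count (fun b => (b.1 <= b1)%E && (b2 < b.2)%E) C = count_bars C r1 s0.
    move=> CA; apply: eq_in_count => b /CA bA.
    by rewrite (le1 r1 b1) ?M1 // [(b2 < _)%E]ltNge (le1 s0 b2) ?M2 // -ltNge.
  rewrite !e => [|b bA|b bA]; rewrite ?mem_cat ?bA ?orbT //.
  apply: cut_count => //; [exact: off r1b Mr1|exact: off s0b Ms0|].
  move=> y /Ms0[yb2|s0y]; [right|left].
    exact: le_trans yb2 (ltW s0b).
  exact: le_trans (ltW s0b) (ltW s0y).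
have cut0 : b1 != -oo%E -> exists2 r, (r%:E < b1)%E &
      forall y, y \in M -> (b1 <= y)%E \/ (y < r%:E)%E.
  by move=> b1y; apply: cut_before; rewrite ltNye.
have cut0' r : (r%:E < b1)%E -> (forall y, y \in M -> (b1 <= y)%E \/ (y < r%:E)%E) ->
    forall y, y \in M -> (y <= b1)%E \/ (r%:E < y)%E.
  move=> rb Mr y /Mr[b1y|yr]; [right|left]; first exact: lt_le_trans rb b1y.
  exact: ltW (lt_trans yr rb).
have cnt01 : count (fun b => (b.1 < b1)%E && (b2 <= b.2)%E) A =
             count (fun b => (b.1 < b1)%E && (b2 <= b.2)%E) A'.
  have [->|/cut0[r0 r0b Mr0]] := eqVneq b1 -oo%E.
    by rewrite !(eq_count (a2 := pred0)) ?count_pred0 // => b /=;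
      rewrite ltNge leNye.
  have e C : {subset C <= A ++ A'} ->
      count (fun b => (b.1 < b1)%E && (b2 <= b.2)%E) C = count_bars C r0 s1.
    move=> CA; apply: eq_in_count => b /CA bA.
    by rewrite (lt1 r0 b1) ?M1 // [(b2 <= _)%E]leNgt (lt1 s1 b2) ?M2 // -ltNge.
  rewrite !e => [|b bA|b bA]; rewrite ?mem_cat ?bA ?orbT //.
  apply: cut_count; [exact: cut0'|exact: off' r0b Mr0|exact: off' s1b Ms1|].
  by move=> y /Ms1[|/ltW]; [left|right].
have cnt00 : count (fun b => (b.1 < b1)%E && (b2 < b.2)%E) A =
             count (fun b => (b.1 < b1)%E && (b2 < b.2)%E) A'.
  have [->|/cut0[r0 r0b Mr0]] := eqVneq b1 -oo%E.
    by rewrite !(eq_count (a2 := pred0)) ?count_pred0 // => b /=;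
      rewrite ltNge leNye.
  have [->|b2y] := eqVneq b2 +oo%E.
    by rewrite !(eq_count (a2 := pred0)) ?count_pred0 // => b /=;
      rewrite [X in _ && X]ltNge leey andbF.
  have [s0 s0b Ms0] : exists2 r, (b2 < r%:E)%E &
      forall y, y \in M -> (y <= b2)%E \/ (r%:E < y)%E.
    by apply: cut_after; rewrite ltey.
  have e C : {subset C <= A ++ A'} ->
      count (fun b => (b.1 < b1)%E && (b2 < b.2)%E) C = count_bars C r0 s0.
    move=> CA; apply: eq_in_count => b /CA bA.
    by rewrite (lt1 r0 b1) ?M1 // [(b2 < _)%E]ltNge (le1 s0 b2) ?M2 // -ltNge.
  rewrite !e => [|b bA|b bA]; rewrite ?mem_cat ?bA ?orbT //.
  apply: cut_count; [exact: cut0'|exact: off' r0b Mr0|exact: off s0b Ms0|].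
  move=> y /Ms0[yb2|s0y]; [right|left].
    exact: le_trans yb2 (ltW s0b).
  exact: le_trans (ltW s0b) (ltW s0y).
have := count_mem_bar A b1 b2.
by rewrite cnt11 cnt10 cnt01 cnt00 -count_mem_bar => /addIn/addIn/eqP.
Qed.

End Bars.

(** * From ranks to dual barcodes *)

Section BarcodeDuality.
Variables (R : realType) (X K : fcomplex R) (d : nat) (dl : cell X -> cell K).
Hypotheses (Xc : cell_complex X) (Kc : cell_complex K) (Ka : acyclic K).
Hypothesis dlD : complement_dual d dl.

Lemma barcode_duality (k : int) (B B' : seq (bar R)) :
  is_barcode X k B -> is_barcode K (d%:Z - k - 1) B' ->
  perm_eq [seq dual_bar b | b <- B] (reduced (d%:Z - k - 1) B').
Proof.
move=> BX BK; set j := d%:Z - k - 1 in BK *.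
have [Bb _] := BX; have [B'b _] := BK.
pose D := [seq dual_bar b | b <- B].
pose vals := [seq cval c | c <- enum (cell X)] ++ map fst B ++ map snd B.
(* Thresholds whose opposite is a cell value or an end point are excluded; [fine] sends infinite
   values to 0, which merely excludes 0 as well. *)
pose L : seq R := [seq - fine x | x <- vals].
have Db : all (fun b : bar R => (b.1 < b.2)%E) D.
  by rewrite all_map; apply: sub_all Bb => b /=; rewrite lteN2.
have offL (t : R) x : t \notin L -> x \in vals -> x != (- t)%:E.
  move=> tL xv; apply: contraNneq tL => xE; apply/mapP; exists x => //.
  by rewrite xE /= opprK.
(* Negation exchanges the closed and open ends of a bar; off [L] no end point meets a threshold, so
   strict and large inequalities agree. *)
have cntD t u : t \notin L -> u \notin L ->
    count_bars D t u = count_bars B (- u) (- t).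
  move=> tL uL; rewrite /count_bars count_map; apply: eq_in_count => b bB /=.
  have b1 := offL u b.1 uL; have b2 := offL t b.2 tL.
  rewrite andbC EFinN lteNr -EFinN [(- b.2 <= _)%E]leeNl -EFinN; congr (_ && _).
    by rewrite lt_neqAle b1 // !mem_cat map_f // ?orbT.
  by rewrite le_eqVlt eq_sym (negbTE (b2 _)) // !mem_cat (map_f snd) // !orbT.
have cnt t u : t <= u -> t \notin L -> u \notin L ->
    count_bars B' t u = (count_bars D t u + (j == 0%R))%N.
  move=> tu tL uL; rewrite cntD // /count_bars.
  rewrite (barcode_count BK) ?lee_fin ?ltry //.
  rewrite (barcode_count BX) ?ltry //; last first.
    by rewrite lee_fin lerN2.
  rewrite -(@duality_rank R X K d dl Xc Kc Ka dlD k (- u) (- t)) ?opprK ?lerN2 //.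
    by move=> c; apply: offL; rewrite // mem_cat map_f // mem_enum.
  by move=> c; apply: offL; rewrite // mem_cat map_f // mem_enum.
rewrite /reduced; case: (eqVneq j 0) cnt => [_|_] cnt.
  (* The extra 1 in degree 0 is the bar that contains every threshold; adding it to the dual bars
     gives equal counts, and [rem] then takes it off. *)
  have : perm_eq ((-oo%E, +oo%E) :: D) B'.
    apply: (@count_bars_perm _ _ _ L) => //= t u tu tL uL.
    by rewrite cnt // /count_bars /= leNye ltry addnC.
  move=> DB'; have xB' : (-oo%E, +oo%E) \in B' by rewrite -(perm_mem DB') mem_head.
  by rewrite -(perm_cons (-oo%E, +oo%E)) (perm_trans DB') // perm_to_rem.
apply: (@count_bars_perm _ _ _ L) => //= t u tu tL uL.
by rewrite cnt // addn0.
Qed.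

End BarcodeDuality.

Section ImageDuality.
Variables (R : realType) (d : nat) (n : 'I_d -> nat) (I : pixel n -> R).
Hypothesis d_gt0 : (0 < d)%N.

Lemma edim_origin (m : 'I_d -> nat) :
  edim ([ffun i => inl ord0] : ecube (fun i => (m i).+1)) = 0%N.
Proof. by rewrite edimE big1 // => i _; rewrite ffunE. Qed.

Lemma complement_dual_VT : (forall i, 0 < n i)%N ->
  complement_dual (X := Vcomplex (ext_image I)) (K := Tcomplex (neg_padded I))
    d (@dual_VT d n).
Proof.
move=> n_gt0; split.
- by apply: dual_cube_inj => i a a'; exact: dualVT_face.
- by apply: edim_dual_cube => i a; exact: dualVT_edge.
- apply: facet_dual_cube => i a *; [exact: dualVT_edge|exact: dualVT_face].
- exact: cval_dual_VT.
- by move=> c; exact: cval_notin_dual_VT.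
(* The corner at the origin lies in the padding: the points in the image of [dualVT] are at least 2,
   and [d_gt0] supplies a direction to test. *)
exists [ffun i => inl ord0]; first exact: edim_origin.
apply: (@origin_notin_dual_cube _ _ _ _ (Ordinal d_gt0)) => a.
rewrite ffunE; case: a => // l; apply/eqP => -[/(congr1 val)] /=.
by rewrite inordK //; have := ltn_ord l; lia.
Qed.

Lemma complement_dual_TV :
  complement_dual (X := Tcomplex (ext_image I)) (K := Vcomplex (neg_padded I))
    d (@dual_TV d n).
Proof.
split.
- by apply: dual_cube_inj => i a a'; exact: dualTV_face.
- by apply: edim_dual_cube => i a; exact: dualTV_edge.
- apply: facet_dual_cube => i a *; [exact: dualTV_edge|exact: dualTV_face].
- exact: cval_dual_TV.
- by move=> c; exact: cval_notin_dual_TV.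
exists [ffun i => inl ord0]; first exact: edim_origin.
apply: (@origin_notin_dual_cube _ _ _ _ (Ordinal d_gt0)) => a.
rewrite ffunE; case: a => // l; apply/eqP => -[/(congr1 val)] /=.
by rewrite inordK // ltnS; exact: leqW (ltn_ord l).
Qed.

End ImageDuality.

Theorem theorem3p1 (R : realType) (d : nat) (d_gt0 : (0 < d)%N)
    (n : 'I_d -> nat) (n_gt0 : forall i, (0 < n i)%N) (I : pixel n -> R)
    (k : int) :
  (forall B B' : seq (bar R),
     is_barcode (Vcomplex (ext_image I)) k B ->
     is_barcode (Tcomplex (neg_padded I)) (d%:Z - k - 1) B' ->
     perm_eq [seq dual_bar b | b <- B] (reduced (d%:Z - k - 1) B')) /\
  (forall B B' : seq (bar R),
     is_barcode (Tcomplex (ext_image I)) k B ->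
     is_barcode (Vcomplex (neg_padded I)) (d%:Z - k - 1) B' ->
     perm_eq [seq dual_bar b | b <- B] (reduced (d%:Z - k - 1) B')).
Proof.
split=> B B'.
- exact: (barcode_duality (Vcomplex_complex _) (Tcomplex_complex _)
    (Tcomplex_acyclic _) (complement_dual_VT I d_gt0 n_gt0)).
- exact: (barcode_duality (Tcomplex_complex _) (Vcomplex_complex _)
    (Vcomplex_acyclic _) (complement_dual_TV I d_gt0)).
Qed.
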